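(* Let $\sigma=\sigma^{\mathrm{FT}}:=\sigma^\infty+\delta\mathbf{1}$ for some $\delta>0$, with $\sigma^\infty$ the asymptotic restriction defined in the context. Assume that the restricted problem $\mathrm{LP}(\sigma^{\mathrm{FT}})$ is feasible and that its optimal solution is unique. Let the step-size sequence $\{\alpha^t\}_{t\ge 0}$, with each $\alpha^t\ge 0$, satisfy $\sum_{t=0}^\infty \alpha^t=\infty$ and $\sum_{t=0}^\infty(\alpha^t)^2<\infty$. Consider the mixed-integer sequence $\{x_1^t,\ldots,x_N^t\}_{t\ge0}$ generated by the distributed algorithm described in the context, with a sufficiently large $M>0$ and with initialization satisfying $\sum_{i=1}^N y_i^0=b-\sigma^{\mathrm{FT}}$. Then there exists a sufficiently large time $T_\delta>0$ such that the vector $(x_1^t,\ldots,x_N^t)$ is a feasible solution of the target MILP, i.e., $x_i^t\in X_i$ for all $i\in\{1,\ldots,N\}$ and $\sum_{i=1}^N A_ix_i^t\le b$, for all $t\ge T_\delta$.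
   Context: Setting. There are $N$ agents and $S$ linear coupling constraints (the regime of interest is $N\gg S$; no quantitative relation is imposed). For each $i\in\{1,\ldots,N\}$: $X_i=P_i\cap(\mathbb{Z}^{p_i}\times\mathbb{R}^{q_i})$ with $P_i\subset\mathbb{R}^{p_i+q_i}$ a nonempty compact polyhedron, $c_i\in\mathbb{R}^{p_i+q_i}$, $A_i\in\mathbb{R}^{S\times(p_i+q_i)}$; and $b\in\mathbb{R}^S$. The target MILP is: minimize $\sum_{i=1}^N c_i^\top x_i$ subject to $\sum_{i=1}^N A_ix_i\le b$ and $x_i\in X_i$ for all $i$; it is assumed feasible. Vector inequalities are componentwise, $\max$ and $\min$ of vectors are componentwise, $[\cdot]_s$ is the $s$-th component, $\mathbf{1}$ is the vector of ones, and $\mathrm{conv}(X_i)$ is the convex hull of $X_i$. Restricted problem $\mathrm{LP}(\sigma)$, for $\sigma\in\mathbb{R}^S$, $\sigma\ge0$: minimize $\sum_{i=1}^N c_i^\top z_i$ over $z_1,\dots,z_N$ subject to $\sum_{i=1}^N A_iz_i\le b-\sigma$ and $z_i\in\mathrm{conv}(X_i)$ for all $i$. Asymptotic restriction: let $L_i=\min_{x_i\in X_i}A_ix_i\in\mathbb{R}^S$ (componentwise), $\rho_i^{\max}=\min_{x_i\in X_i}\max_{s\in\{1,\ldots,S\}}[A_ix_i-L_i]_s$, $\sigma_i^{\mathrm{loc}}=\min\{\rho_i^{\max}\mathbf{1},\ \max_{x_i\in X_i}(A_ix_i-L_i)\}\in\mathbb{R}^S$ (componentwise), and $\sigma^\infty=S\cdot\max_{i\in\{1,\ldots,N\}}\sigma_i^{\mathrm{loc}}\in\mathbb{R}^S$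 (componentwise). Communication graph: agents communicate over a connected undirected graph on $\{1,\ldots,N\}$; $\mathcal{N}_i$ is the set of neighbors of $i$. Local problem $\mathrm{Loc}_i(y_i)$, for a parameter $M>0$: minimize $c_i^\top z_i+Mv_i$ over $(z_i,v_i)$ subject to $A_iz_i\le y_i+v_i\mathbf{1}$, $z_i\in\mathrm{conv}(X_i)$, $v_i\ge 0$, with $v_i\in\mathbb{R}$. Lexicographic problem $\mathrm{Lex}_i(y_i)$: minimize lexicographically $\rho_i$, then $\xi_i$, over $(\rho_i,\xi_i,x_i)$ subject to $c_i^\top x_i\le\xi_i$, $A_ix_i\le y_i+\rho_i\mathbf{1}$, $x_i\in X_i$, $\rho_i\ge0$. Equivalently: first let $\bar\rho_i$ be the minimum of $\rho_i\ge 0$ such that some $x_i\in X_i$ satisfies $A_ix_i\le y_i+\rho_i\mathbf{1}$; then $x_i$ is a minimizer of $c_i^\top x_i$ over $x_i\in X_i$ with $A_ix_i\le y_i+\bar\rho_i\mathbf{1}$. Distributed algorithm: starting from $y_1^0,\ldots,y_N^0\in\mathbb{R}^S$, at each iteration $t\ge 0$, each agent $i$ computes a Lagrange multiplier $\mu_i^t$ of $\mathrm{Loc}_i(y_i^t)$ associated with the constraint $A_iz_i\le y_i^t+v_i\mathbf{1}$, receives $\mu_j^t$ from $j\in\mathcal{N}_i$, and updates $y_i^{t+1}=y_i^t+\alpha^t\sum_{j\in\mathcal{N}_i}(\mu_i^t-\mu_j^t)$. If halted at iteration $t$, agent $i$ returns $x_i^t$, the $x_i$-part of an optimal solution of $\mathrm{Lex}_i(y_i^t)$;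 the mixed-integer sequence is $\{x_1^t,\ldots,x_N^t\}_{t\ge 0}$. *)

(* Defs.v *)
From mathcomp Require Import all_boot all_order all_algebra.
From mathcomp Require Import boolp classical_sets functions reals topology.
From mathcomp Require Import normedtype sequences.

Set Implicit Arguments.
Unset Strict Implicit.
Unset Printing Implicit Defensive.

Import Order.TTheory GRing.Theory Num.Theory.
Import numFieldNormedType.Exports.

Local Open Scope classical_set_scope.
Local Open Scope ring_scope.

Section Extrema.
Variable R : realType.
Implicit Type E : set R.

Definition minimums E : set R := E `&` lbound E.
Definition maximums E : set R := E `&` ubound E.

(* [setmin E] and [setmax E] are the attained minimum and maximum of [E]. The
   default value 0 is returned when there is none; this concerns no set used
   below as soon as the sets of agents, of coupling constraints and of local
   decisions are nonempty, the latter being moreover compact. *)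
Definition setmin E : R := xget 0 (minimums E).
Definition setmax E : R := xget 0 (maximums E).

End Extrema.

Section Vectors.
Variable R : realType.

Definition vle n (u v : 'cV[R]_n) : Prop := forall s, u s 0 <= v s 0.

Definition dot n (u v : 'cV[R]_n) : R := (u^T *m v) 0 0.

Definition polyhedron n (P : set 'cV[R]_n) : Prop :=
  exists (m : nat) (G : 'M[R]_(m, n)) (h : 'cV[R]_m),
    P = [set x | vle (G *m x) h].

Definition convex_hull n (X : set 'cV[R]_n) : set 'cV[R]_n :=
  [set z | exists (k : nat) (w : 'I_k -> R) (v : 'I_k -> 'cV[R]_n),
    [/\ forall j, 0 <= w j, \sum_(j < k) w j = 1, forall j, X (v j)
      & z = \sum_(j < k) w j *: v j]].

(* P `&` (Z^p x R^q) *)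
Definition mixed_integer_points p q (P : set 'cV[R]_(p + q)) :
    set 'cV[R]_(p + q) :=
  [set x | P x /\ forall j : 'I_p, usubmx x j 0 \is a Num.int].

End Vectors.

Section Agent.
Variables (R : realType) (S n : nat).
Variables (c : 'cV[R]_n) (A : 'M[R]_(S, n)) (X : set 'cV[R]_n).

Definition lower_resource : 'cV[R]_S :=
  \col_s setmin [set (A *m x) s 0 | x in X].

Definition rho_max : R :=
  setmin [set setmax (range (fun s : 'I_S => (A *m x - lower_resource) s 0))
         | x in X].

Definition sigma_loc : 'cV[R]_S :=
  \col_s Num.min rho_max
           (setmax [set (A *m x - lower_resource) s 0 | x in X]).

Definition loc_domain : set ('cV[R]_n * R) :=
  [set zv | convex_hull X zv.1 /\ 0 <= zv.2].

Definition loc_cost (M : R) (zv : 'cV[R]_n * R) : R := dot c zv.1 + M * zv.2.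

Definition loc_feasible (y : 'cV[R]_S) : set ('cV[R]_n * R) :=
  [set zv | loc_domain zv /\ vle (A *m zv.1) (y + const_mx zv.2)].

(* Only A z <= y + v 1 is dualized. *)
Definition loc_lagrangian (M : R) (y mu : 'cV[R]_S) (zv : 'cV[R]_n * R) : R :=
  loc_cost M zv + dot mu (A *m zv.1 - (y + const_mx zv.2)).

(* mu is nonnegative and the infimum of the Lagrangian over
   conv(X) x [0, +oo[ is the optimal value of the local problem. *)
Definition loc_multiplier (M : R) (y mu : 'cV[R]_S) : Prop :=
  vle 0 mu /\
  exists f : R, minimums [set loc_cost M zv | zv in loc_feasible y] f /\
                infimums [set loc_lagrangian M y mu zv | zv in loc_domain] f.

Definition lex_feasible (y : 'cV[R]_S) (rho xi : R) (x : 'cV[R]_n) : Prop :=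
  [/\ dot c x <= xi, vle (A *m x) (y + const_mx rho), X x & 0 <= rho].

Definition lex_solution (y : 'cV[R]_S) (x : 'cV[R]_n) : Prop :=
  exists rho xi : R, lex_feasible y rho xi x /\
    forall rho' xi' x', lex_feasible y rho' xi' x' ->
      rho < rho' \/ (rho = rho' /\ xi <= xi').

End Agent.

Section Network.
Variables (R : realType) (N S : nat) (n : 'I_N -> nat).
Variables (c : forall i, 'cV[R]_(n i)) (A : forall i, 'M[R]_(S, n i)).
Variables (X : forall i, set 'cV[R]_(n i)) (b : 'cV[R]_S).
Arguments X : clear implicits.

Definition milp_feasible (x : forall i, 'cV[R]_(n i)) : Prop :=
  (forall i, X i (x i)) /\ vle (\sum_(i < N) A i *m x i) b.

Definition total_cost (z : forall i, 'cV[R]_(n i)) : R :=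
  \sum_(i < N) dot (c i) (z i).

Definition lp_feasible (sigma : 'cV[R]_S) (z : forall i, 'cV[R]_(n i)) : Prop :=
  (forall i, convex_hull (X i) (z i)) /\
  vle (\sum_(i < N) A i *m z i) (b - sigma).

Definition lp_optimal (sigma : 'cV[R]_S) (z : forall i, 'cV[R]_(n i)) : Prop :=
  lp_feasible sigma z /\
  forall z', lp_feasible sigma z' -> total_cost z <= total_cost z'.

Definition sigma_infty : 'cV[R]_S :=
  S%:R *: \col_s setmax (range (fun i => sigma_loc (A i) (X i) s 0)).

Definition sigma_FT (delta : R) : 'cV[R]_S := sigma_infty + const_mx delta.

(* [y], [mu] and [x] are sequences of allocations, multipliers and
   mixed-integer outputs generated by the algorithm with penalty [M], step
   sizes [alpha] and communication graph [e]. *)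
Definition algorithm_run (e : rel 'I_N) (M : R) (alpha : nat -> R)
    (y mu : nat -> 'I_N -> 'cV[R]_S)
    (x : nat -> forall i, 'cV[R]_(n i)) : Prop :=
  forall (t : nat) (i : 'I_N),
    [/\ loc_multiplier (c i) (A i) (X i) M (y t i) (mu t i),
        y t.+1 i = y t i + alpha t *: \sum_(j | e i j) (mu t i - mu t j)
      & lex_solution (c i) (A i) (X i) (y t i) (x t i)].

End Network.

(* Main.v *)
Require Import Defs.
From mathcomp Require Import all_boot all_order all_algebra.
From mathcomp Require Import boolp classical_sets functions reals topology.
From mathcomp Require Import normedtype sequences.
From mathcomp Require Import zify ring lra.

(** Exchanging multipliers between neighbours preserves the sum of the allocations
    and is a subgradient step for the problem of minimizing the sum of the local
    optimal values over the allocations of total [b - sigma]. In the norm given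
    by the pseudo-inverse of the graph Laplacian ([energy_step]), the squared
    distance to an optimal allocation decreases up to terms of the order of
    [alpha t ^+ 2]. Two facts identify the limit. First, each [X i] is spanned by
    finitely many of its points ([mixed_integer_finite_hull]), so that the
    restricted problem is a linear program with a multiplier; a penalty [M] above
    the sum of its entries is exact ([exact_penalty]). Secondly, the step sizes
    have infinite sum, so that the penalized cost comes arbitrarily close to its
    optimal value; by exactness and uniqueness, limits of the local solutions at
    such times are the optimum [zopt] of the restricted problem
    ([cluster_reference]). Hence the allocations converge, and eventually
    [A i *m zopt i] complies with the allocation of every agent up to an
    arbitrarily small [eps] ([allocations_converge]).

    What remains is a comparison of resources at a fixed late time. An agent with
    [zopt i] in [X i] recovers a mixed-integer point violating its allocation by
    at most [eps] ([lex_resource_integral]); any other agent exceeds it by at most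
    [eps] plus [sigma_loc] ([lex_resource]). There are at most [S] agents of the
    second kind, since otherwise their components could be perturbed both ways
    without changing the resources used, against uniqueness
    ([unique_optimum_few_fractional]). The total excess is therefore at most
    [sigma_infty] plus [N * eps], and the choice [eps = delta / N] makes it at most
    the restriction [sigma_FT]. *)

Set Implicit Arguments.
Unset Strict Implicit.
Unset Printing Implicit Defensive.

Import Order.TTheory GRing.Theory Num.Theory.
Import numFieldNormedType.Exports.

Local Open Scope classical_set_scope.
Local Open Scope ring_scope.

(** * Vectors, coordinates and scalar products *)

Section Vectors.
Variable R : realType.

Lemma shift_coord m (y : 'cV[R]_m) r s :
  (y + const_mx r) s 0 = y s 0 + r.
Proof. by rewrite mxE [X in _ + X]mxE. Qed.

Lemma sub_coord m (x y : 'cV[R]_m) s : (x - y) s 0 = x s 0 - y s 0.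
Proof. by rewrite mxE [X in _ + X]mxE. Qed.

Lemma dotDr m (u x y : 'cV[R]_m) : dot u (x + y) = dot u x + dot u y.
Proof. by rewrite /dot mulmxDr mxE. Qed.

Lemma dotZr m (u x : 'cV[R]_m) a : dot u (a *: x) = a * dot u x.
Proof. by rewrite /dot -scalemxAr mxE. Qed.

Lemma dotNr m (u x : 'cV[R]_m) : dot u (- x) = - dot u x.
Proof. by rewrite -scaleN1r dotZr mulN1r. Qed.

Lemma dot_sumr m (u : 'cV[R]_m) (I : finType) (x : I -> 'cV[R]_m) :
  dot u (\sum_i x i) = \sum_i dot u (x i).
Proof. by rewrite /dot mulmx_sumr summxE. Qed.

Lemma dotE m (u x : 'cV[R]_m) : dot u x = \sum_s u s 0 * x s 0.
Proof. by rewrite /dot mxE; apply: eq_bigr => s _; rewrite mxE. Qed.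

Lemma dot_le m (u x y : 'cV[R]_m) : vle 0 u -> vle x y -> dot u x <= dot u y.
Proof.
move=> u0 xy; rewrite !dotE; apply: ler_sum => s _; rewrite ler_wpM2l//.
by have := u0 s; rewrite mxE.
Qed.

Lemma dot_line m (u x d : 'cV[R]_m) t : dot u (x + t *: d) = dot u x + t * dot u d.
Proof. by rewrite /dot mulmxDr -scalemxAr mxE [X in _ + X]mxE. Qed.

End Vectors.

(** * Farkas' lemma by Fourier-Motzkin elimination *)

Section Farkas.
Variable R : realType.

Lemma finite_separation (K : finType) (P Q : pred K) (l : K -> R) :
  (forall p q, P p -> Q q -> l p <= l q) ->
  exists t, (forall p, P p -> l p <= t) /\ (forall q, Q q -> t <= l q).
Proof.
move=> PQ; have [/existsP[p0 Pp0]|/existsPn noP] := boolP [exists p, P p].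
  case: (Order.TotalTheory.arg_maxP l Pp0) => p Pp pmax.
  by exists (l p); split=> [p' /pmax//|q Qq]; exact: PQ.
have [/existsP[q0 Qq0]|/existsPn noQ] := boolP [exists q, Q q].
  case: (Order.TotalTheory.arg_minP l Qq0) => q Qq qmin.
  by exists (l q); split=> [p Pp|q' /qmin//]; have := noP p; rewrite Pp.
by exists 0; split=> [p Pp|q Qq]; [have := noP p; rewrite Pp
                                  |have := noQ q; rewrite Qq].
Qed.

(** By induction on the number of variables: the last one is eliminated by
    combining each constraint where its coefficient is positive with each one
    where it is negative, which preserves solvability by [finite_separation].
    A certificate for the combined constraints expands into one for the original
    constraints. *)
Lemma affine_farkas (n : nat) (K : finType) (g : K -> nat -> R) (h : K -> R) :
  (exists mu : nat -> R, forall k, 0 <= \sum_(i < n) g k i * mu i + h k) \/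
  (exists w : K -> R, [/\ forall k, 0 <= w k,
     forall i, (i < n)%N -> \sum_k w k * g k i = 0 & \sum_k w k * h k < 0]).
Proof.
elim: n K g h => [|n IH] K g h.
  have [/forallP h0|/forallPn[k hk]] := boolP [forall k, 0 <= h k].
    by left; exists (fun=> 0) => k; rewrite big_ord0 add0r.
  right; exists (fun k' => (k' == k)%:R); split=> [k'|//|].
    by rewrite ler0n.
  rewrite (bigD1 k)//= eqxx mul1r big1 ?addr0 ?ltNge// => k' /negbTE ->.
  by rewrite mul0r.
pose dl (k k' : K) : R := (k' == k)%:R.
have dlE k (F : K -> R) : \sum_k' dl k k' * F k' = F k.
  rewrite (bigD1 k)//= /dl eqxx mul1r big1 ?addr0// => k' /negbTE ->.
  by rewrite mul0r.
(* Weights, over the original constraints, of the combined constraint [k']; an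
   index that corresponds to no combination carries the constraint 0 <= 0. *)
pose comb (k' : K + K * K) (k : K) : R := match k' with
  | inl p => if g p n == 0 then dl p k else 0
  | inr pq => if (0 < g pq.1 n) && (g pq.2 n < 0)
              then - g pq.2 n * dl pq.1 k + g pq.1 n * dl pq.2 k else 0 end.
have comb0 k' k : 0 <= comb k' k.
  case: k' => [p|[p q]] /=; first by case: ifP => // _; rewrite /dl ler0n.
  case: ifP => // /andP[p0 q0].
  by rewrite addr_ge0// mulr_ge0 ?ler0n// ?oppr_ge0 ltW.
have combE k' (F : K -> R) : \sum_k comb k' k * F k = match k' with
  | inl p => if g p n == 0 then F p else 0
  | inr pq => if (0 < g pq.1 n) && (g pq.2 n < 0)
              then - g pq.2 n * F pq.1 + g pq.1 n * F pq.2 else 0 end.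
  case: k' => [p|[p q]] /=; case: ifP => // _.
  - by rewrite big1// => k _; rewrite mul0r.
  - under eq_bigr do rewrite mulrDl -!mulrA.
    by rewrite big_split/= -!mulr_sumr !dlE.
  - by rewrite big1// => k _; rewrite mul0r.
have [[mu muP]|[w [w0 wg wh]]] := IH _ (fun k' i => \sum_k comb k' k * g k i)
  (fun k' => \sum_k comb k' k * h k); last first.
  right; exists (fun k => \sum_k' w k' * comb k' k).
  have sumE (F : K -> R) : \sum_k (\sum_k' w k' * comb k' k) * F k =
      \sum_k' w k' * \sum_k comb k' k * F k.
    under eq_bigr do rewrite mulr_suml.
    rewrite exchange_big/=; apply: eq_bigr => k' _.
    by rewrite mulr_sumr; apply: eq_bigr => k _; rewrite mulrA.
  split=> [k|i|].
  - by apply: sumr_ge0 => k' _; rewrite mulr_ge0.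
  - rewrite ltnS leq_eqVlt => /orP[/eqP ->|/wg]; last by rewrite sumE.
    rewrite sumE big1// => k' _; rewrite combE; case: k' => [p|[p q]] /=.
      by case: eqP => [->|_]; rewrite mulr0.
    by case: ifP => _; rewrite ?mulr0// (mulrC (g p n)) addrC mulNr subrr mulr0.
  - by rewrite sumE.
pose r k := \sum_(i < n) g k i * mu i + h k.
have rP k' : 0 <= \sum_k comb k' k * r k.
  have := muP k'; congr (_ <= _); rewrite /r.
  under [RHS]eq_bigr do rewrite mulrDr mulr_sumr.
  rewrite big_split/= exchange_big/=; congr (_ + _).
  by apply: eq_bigr => i _; rewrite mulr_suml; apply: eq_bigr => k _; rewrite mulrA.
have [|t [tlo tup]] := @finite_separation K (fun p => 0 < g p n)
  (fun q => g q n < 0) (fun k => - r k / g k n).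
  move=> p q p0 q0; have := rP (inr (p, q)); rewrite combE/= p0 q0/= => pq.
  rewrite ler_pdivrMr// mulrAC ler_ndivlMr//.
  by nra.
left; exists (fun i => if i == n then t else mu i) => k.
rewrite big_ord_recr/= eqxx.
under eq_bigr => i _ do rewrite (ltn_eqF (ltn_ord i)).
have -> : \sum_(i < n) g k i * mu i = r k - h k by rewrite /r addrK.
have [k0|k0|k0] := ltgtP (g k n) 0.
- by have := tup _ k0; rewrite ler_ndivlMr// => ?; nra.
- by have := tlo _ k0; rewrite ler_pdivrMr// => ?; nra.
- by have := rP (inl k); rewrite combE k0 eqxx => ?; nra.
Qed.

Lemma farkas (n : nat) (K : finType) (g : K -> 'I_n -> R) (h : K -> R) :
  (exists mu : 'I_n -> R, forall k, 0 <= \sum_i g k i * mu i + h k) \/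
  (exists w : K -> R, [/\ forall k, 0 <= w k,
     forall i, \sum_k w k * g k i = 0 & \sum_k w k * h k < 0]).
Proof.
pose g' k j := if insub j : option 'I_n is Some i then g k i else 0.
have [[mu muP]|[w [w0 wg wh]]] := affine_farkas n g' h.
  left; exists (fun i => mu i) => k; have := muP k; rewrite /g'.
  by under eq_bigr do rewrite valK.
right; exists w; split=> // i; have := wg i (ltn_ord i); rewrite /g'.
by under eq_bigr do rewrite valK.
Qed.

End Farkas.

(** * The Laplacian of a connected graph *)

Section Laplacian.
Variables (R : realType) (N : nat) (e : rel 'I_N).
Hypotheses (e_sym : symmetric e) (e_conn : forall i j, connect e i j).
Implicit Types u d : 'rV[R]_N.

Definition laplacian : 'M[R]_N :=
  \matrix_(i, j) ((i == j)%:R * (\sum_k (e i k)%:R) - (e i j)%:R).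

Let L := laplacian.

Lemma laplacianT : L^T = L.
Proof.
apply/matrixP => i j; rewrite !mxE e_sym eq_sym; congr (_ - _).
by case: eqP => [->//|_]; rewrite !mul0r.
Qed.

Lemma mul_laplacian u j : (u *m L) 0 j = \sum_(i | e j i) (u 0 j - u 0 i).
Proof.
rewrite mxE; under eq_bigr do rewrite mxE mulrBr.
rewrite sumrB (bigD1 j)//= eqxx mul1r [X in _ + X - _]big1 ?addr0; last first.
  by move=> i /negbTE ->; rewrite mul0r mulr0.
rewrite mulr_sumr -sumrB [RHS]big_mkcond; apply: eq_bigr => i _.
by rewrite (e_sym i j); case: (e j i); rewrite ?mulr1// !mulr0 subr0.
Qed.

Lemma laplacian_formC (u v : 'rV[R]_N) : (u *m L *m v^T) 0 0 = (v *m L *m u^T) 0 0.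
Proof.
by rewrite -[in LHS](trmxK (u *m L *m v^T)) mxE !trmx_mul trmxK laplacianT mulmxA.
Qed.

Lemma laplacian_form u :
  2 * (u *m L *m u^T) 0 0 = \sum_i \sum_(j | e i j) (u 0 i - u 0 j) ^+ 2.
Proof.
have formE : (u *m L *m u^T) 0 0 =
    \sum_i \sum_(j | e i j) (u 0 i - u 0 j) * u 0 i.
  rewrite mxE; apply: eq_bigr => i _.
  by rewrite mul_laplacian mxE mulr_suml.
have formE' : (u *m L *m u^T) 0 0 =
    \sum_i \sum_(j | e i j) (u 0 j - u 0 i) * u 0 j.
  rewrite formE (exchange_big_dep xpredT)//=; apply: eq_bigr => j _.
  by apply: eq_bigl => i; rewrite e_sym.
rewrite mulr_natl mulr2n {1}formE formE' -big_split/=; apply: eq_bigr => i _.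
by rewrite -big_split/=; apply: eq_bigr => j _; ring.
Qed.

Lemma laplacian_form_edge u i j : e i j ->
  (u 0 i - u 0 j) ^+ 2 <= 2 * (u *m L *m u^T) 0 0.
Proof.
move=> eij; rewrite laplacian_form (bigD1 i)//= (bigD1 j)//= -addrA lerDl.
by rewrite addr_ge0// sumr_ge0// => k _; rewrite ?sqr_ge0// sumr_ge0// => l _;
   rewrite sqr_ge0.
Qed.

Lemma laplacian_form_ge0 u : 0 <= (u *m L *m u^T) 0 0.
Proof.
rewrite -(pmulr_rge0 _ (ltr0n R 2)) laplacian_form.
by do 2!(rewrite sumr_ge0// => ? _); rewrite sqr_ge0.
Qed.

Lemma laplacian_form_le u M : (forall i, 0 <= u 0 i <= M) ->
  (u *m L *m u^T) 0 0 <= (N * N)%:R * M ^+ 2.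
Proof.
move=> uM; rewrite (le_trans (_ : _ <= 2 * (u *m L *m u^T) 0 0))//.
  by rewrite ler_peMl ?laplacian_form_ge0// ler1n.
have NE (x : R) : (N * N)%:R * x = \sum_(i < N) \sum_(j < N) x.
  by rewrite !big_const_ord iter_addr_0 iter_addr_0 mulr_natl mulrnA.
rewrite laplacian_form NE; apply: ler_sum => i _.
rewrite big_mkcond; apply: ler_sum => j _; case: ifP => _; last exact: sqr_ge0.
by have := uM i; have := uM j; nra.
Qed.

Lemma laplacian_ker u : u *m L = 0 -> forall i j, u 0 i = u 0 j.
Proof.
move=> uL0; have uE i j : e i j -> u 0 i = u 0 j.
  move=> /(laplacian_form_edge u); rewrite uL0 mul0mx mxE mulr0 => h.
  by apply/eqP; rewrite -subr_eq0 -sqrf_eq0 eq_le h sqr_ge0.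
move=> i j; have /connectP[s] := e_conn i j.
elim: s i => [i _ ->//|k s IH i /= /andP[/uE -> ks] js]; exact: IH.
Qed.

(** The columns of the cokernel matrix are annihilated by the Laplacian, hence
    constant by connectedness, hence orthogonal to every zero-sum vector. *)
Lemma zero_sum_laplacian d : \sum_i d 0 i = 0 -> (d <= L)%MS.
Proof.
move=> d0; rewrite submxE; apply/eqP/rowP => j; rewrite !mxE.
have colE i : cokermx L i j = cokermx L j j.
  have L0 : row j (cokermx L)^T *m L = 0.
    by rewrite -row_mul -[X in row j (_ *m X)]laplacianT -trmx_mul mulmx_coker trmx0 row0.
  by have := laplacian_ker L0 i j; rewrite !mxE.
under eq_bigr do rewrite colE.
by rewrite -mulr_suml d0 mul0r.
Qed.

(** The quadratic form of the pseudo-inverse of the Laplacian, a squared norm on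
    zero-sum vectors. Its inner product of [d] with a Laplacian step [u *m L] is
    the ordinary scalar product of [d] and [u] ([energy_step]): measured by this
    norm, exchanging differences of multipliers between neighbours is a plain
    subgradient step. *)
Definition energy d : R := (d *m pinvmx L *m d^T) 0 0.

Lemma energyE d : \sum_i d 0 i = 0 ->
  energy d = (d *m pinvmx L *m L *m (d *m pinvmx L)^T) 0 0.
Proof.
move=> /zero_sum_laplacian dL; rewrite /energy.
rewrite -{2}(mulmxKpV dL) [(_ *m L)^T]trmx_mul laplacianT.
by rewrite (mulmxA _ L).
Qed.

Lemma energy_ge0 d : \sum_i d 0 i = 0 -> 0 <= energy d.
Proof. by move=> d0; rewrite energyE// laplacian_form_ge0. Qed.

(** Writing [d = u *m L], each coordinate of [d] is a sum of differences of [u]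
    along edges, all of which are controlled by the Laplacian form. *)
Lemma energy_coord d j : \sum_i d 0 i = 0 ->
  `|d 0 j| <= N%:R * Num.sqrt (2 * energy d).
Proof.
move=> d0; rewrite energyE//; set u := d *m pinvmx L.
have -> : d = u *m L by rewrite mulmxKpV// zero_sum_laplacian.
rewrite mul_laplacian (le_trans (ler_norm_sum _ _ _))//.
have -> : N%:R * Num.sqrt (2 * (u *m L *m u^T) 0 0) =
   \sum_(i < N) Num.sqrt (2 * (u *m L *m u^T) 0 0).
  by rewrite big_const_ord iter_addr_0 mulr_natl.
rewrite big_mkcond; apply: ler_sum => i _; case: ifP => [eji|_].
  by rewrite -sqrtr_sqr ler_wsqrtr// laplacian_form_edge.
exact: sqrtr_ge0.
Qed.

Definition energy_cst : R := \sum_i \sum_j `|pinvmx L j i|.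

Lemma energy_le d r : (forall i, `|d 0 i| <= r) -> energy d <= energy_cst * r ^+ 2.
Proof.
move=> dr; rewrite /energy /energy_cst mxE mulr_suml; apply: ler_sum => i _.
rewrite !mxE mulr_suml mulr_suml; apply: ler_sum => j _.
rewrite (le_trans (ler_norm _))// !normrM.
have := normr_ge0 (pinvmx L j i); have := dr i; have := dr j.
have := normr_ge0 (d 0 i); have := normr_ge0 (d 0 j).
move: `|d 0 i| `|d 0 j| `|pinvmx L j i| => a a' k a'0 a0 a'r ar k0.
have : a' * a <= r ^+ 2 by nra.
by nra.
Qed.

Lemma energy_step d u a : \sum_i d 0 i = 0 ->
  energy (d + a *: (u *m L)) =
  energy d + 2 * a * (d *m u^T) 0 0 + a ^+ 2 * (u *m L *m u^T) 0 0.
Proof.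
move=> /zero_sum_laplacian dL; rewrite /energy.
have dE : (d *m pinvmx L *m (u *m L)^T) 0 0 = (d *m u^T) 0 0.
  by rewrite trmx_mul laplacianT mulmxA mulmxKpV.
have dE' : (u *m L *m pinvmx L *m d^T) 0 0 = (d *m u^T) 0 0.
  rewrite -{1}(mulmxKpV dL) trmx_mul laplacianT mulmxA mulmxKpV ?submxMl//.
  by rewrite laplacian_formC mulmxKpV.
have uE : (u *m L *m pinvmx L *m (u *m L)^T) 0 0 = (u *m L *m u^T) 0 0.
  by rewrite trmx_mul laplacianT mulmxA mulmxKpV ?submxMl.
rewrite linearD linearZ/= !(mulmxDl, mulmxDr) -!scalemxAl -!scalemxAr.
by move: dE dE' uE; rewrite !mxE => -> -> ->; ring.
Qed.

End Laplacian.

(** * Convex hulls *)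

Section ConvexHull.
Variable R : realType.

Definition simplex (K : finType) (w : K -> R) : Prop :=
  (forall k, 0 <= w k) /\ \sum_k w k = 1.

(** Unlike [convex_hull], this hull keeps one weight per point of a fixed family,
    so that limits of its points can be taken weight by weight. *)
Definition finite_hull n (K : finType) (V : K -> 'cV[R]_n) : set 'cV[R]_n :=
  [set z | exists2 w, simplex w & z = \sum_k w k *: V k].

Lemma simplex_vertex (K : finType) (k : K) : simplex (fun k' => (k' == k)%:R).
Proof.
split=> [k'|]; first by rewrite ler0n.
by rewrite (bigD1 k)//= eqxx big1 ?addr0// => k' /negbTE ->.
Qed.

Lemma sum_vertex n (K : finType) (k : K) (V : K -> 'cV[R]_n) :
  \sum_k' ((k' == k)%:R : R) *: V k' = V k.
Proof.
rewrite (bigD1 k)//= eqxx scale1r big1 ?addr0// => k' /negbTE ->.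
by rewrite scale0r.
Qed.

Lemma simplex_le1 (K : finType) (w : K -> R) k : simplex w -> w k <= 1.
Proof.
move=> [w0 w1]; rewrite -w1 (bigD1 k)//= lerDl.
exact: sumr_ge0.
Qed.

Lemma finite_hull_vertex n (K : finType) (V : K -> 'cV[R]_n) k :
  finite_hull V (V k).
Proof.
exists (fun k' => (k' == k)%:R); first exact: simplex_vertex.
by rewrite sum_vertex.
Qed.

Lemma finite_hull_segment n (K : finType) (V : K -> 'cV[R]_n) z z' t :
  0 <= t <= 1 -> finite_hull V z -> finite_hull V z' ->
  finite_hull V (t *: z + (1 - t) *: z').
Proof.
move=> /andP[t0 t1] [w [w0 w1] ->] [w' [w'0 w'1] ->].
exists (fun k => t * w k + (1 - t) * w' k).
  split=> [k|]; first by rewrite addr_ge0// mulr_ge0// subr_ge0.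
  by rewrite big_split/= -!mulr_sumr w1 w'1 !mulr1 addrC subrK.
rewrite !scaler_sumr -big_split/=; apply: eq_bigr => k _.
by rewrite [RHS]scalerDl !scalerA.
Qed.

Lemma sub_finite_hull n (X : set 'cV[R]_n) (K : finType) (V : K -> 'cV[R]_n) :
  X `<=` finite_hull V -> convex_hull X `<=` finite_hull V.
Proof.
move=> XV z [m [w [v [w0 w1 vX ->]]]].
have /choice[u uP] j : exists u, simplex u /\ v j = \sum_k u k *: V k.
  by have [u us uE] := XV _ (vX j); exists u.
exists (fun k => \sum_j w j * u j k).
  split=> [k|]; first by apply: sumr_ge0 => j _; rewrite mulr_ge0// (uP j).1.1.
  rewrite exchange_big/= -w1; apply: eq_bigr => j _.
  by rewrite -mulr_sumr (uP j).1.2 mulr1.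
under eq_bigr do rewrite (uP _).2 scaler_sumr.
rewrite exchange_big/=; apply: eq_bigr => k _.
by rewrite scaler_suml; apply: eq_bigr => j _; rewrite scalerA.
Qed.

Lemma convex_hull_finite n (X : set 'cV[R]_n) (K : finType) (V : K -> 'cV[R]_n)
  (w : K -> R) : (forall k, X (V k)) -> simplex w ->
  convex_hull X (\sum_k w k *: V k).
Proof.
move=> VX [w0 w1]; exists #|K|, (w \o enum_val), (V \o enum_val); split=> //=.
- by rewrite -w1 [RHS]big_enum_val.
- by rewrite [LHS]big_enum_val.
Qed.

Lemma convex_hull_segment n (X : set 'cV[R]_n) z z' t :
  0 <= t <= 1 -> convex_hull X z -> convex_hull X z' ->
  convex_hull X (t *: z + (1 - t) *: z').
Proof.
move=> /andP[t0 t1] [m [w [v [w0 w1 vX ->]]]] [m' [w' [v' [w'0 w'1 v'X ->]]]].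
have -> : t *: (\sum_(j < m) w j *: v j) + (1 - t) *: (\sum_(j < m') w' j *: v' j) =
   \sum_(k : 'I_m + 'I_m')
     match k with inl j => t * w j | inr j => (1 - t) * w' j end *:
     match k with inl j => v j | inr j => v' j end.
  rewrite big_sumType/= !scaler_sumr.
  by congr (_ + _); apply: eq_bigr => j _; rewrite scalerA.
apply: convex_hull_finite => [[]//|]; split=> [[j|j]|].
- exact: mulr_ge0.
- by rewrite mulr_ge0// subr_ge0.
- by rewrite big_sumType/= -!mulr_sumr w1 w'1 !mulr1 addrC subrK.
Qed.

Lemma convex_hull_lin_ge n (X : set 'cV[R]_n) m (B : 'M[R]_(m, n)) s l z :
  (forall x, X x -> l <= (B *m x) s 0) -> convex_hull X z -> l <= (B *m z) s 0.
Proof.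
move=> Xl [k [w [v [w0 w1 vX ->]]]].
rewrite mulmx_sumr summxE -[l]mul1r -w1 mulr_suml; apply: ler_sum => j _.
by rewrite -scalemxAr mxE ler_wpM2l// Xl.
Qed.

Lemma finite_hull_lin_ge m (K : finType) (V : K -> 'cV[R]_m) m' (B : 'M[R]_(m', m)) s l z :
  (forall k, l <= (B *m V k) s 0) -> finite_hull V z -> l <= (B *m z) s 0.
Proof.
move=> Vl [w [w0 w1] ->].
rewrite mulmx_sumr summxE -[l]mul1r -w1 mulr_suml; apply: ler_sum => k _.
by rewrite -scalemxAr mxE ler_wpM2l.
Qed.

(** A point of the hull outside [X] is a proper combination of points of [X]:
    moving towards one of them, or away from it, stays in the hull. *)
Lemma convex_hull_not_extreme n (X : set 'cV[R]_n) z :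
  convex_hull X z -> ~ X z ->
  exists d, [/\ d != 0, convex_hull X (z + d) & convex_hull X (z - d)].
Proof.
move=> [k [w [v [w0 w1 vX zE]]]] nXz.
have sw : simplex w by [].
have [j wj0] : exists j, 0 < w j.
  apply/not_existsP => h; have : \sum_j w j = 0.
    by apply: big1 => j _; apply/eqP; rewrite eq_le w0 andbT leNgt; apply/negP.
  by rewrite w1 => /eqP; rewrite oner_eq0.
have sumE (a b : R) : a *: z + b *: v j = \sum_j' (a * w j' + b * (j' == j)%:R) *: v j'.
  under eq_bigr do rewrite scalerDl -!scalerA.
  by rewrite big_split/= -!scaler_sumr -zE sum_vertex.
have smp (a b : R) : a + b = 1 -> (forall j', 0 <= a * w j' + b * (j' == j)%:R) ->
    convex_hull X (a *: z + b *: v j).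
  move=> ab1 ge0; rewrite sumE; apply: convex_hull_finite => //; split=> //.
  by rewrite big_split/= -!mulr_sumr w1 (simplex_vertex j).2 !mulr1.
have wj1 : w j <= 1 by exact: simplex_le1.
exists (w j *: (v j - z)); split.
- rewrite scaler_eq0 negb_or gt_eqF//= subr_eq0.
  by apply/eqP => vz; apply: nXz; rewrite -vz.
- have -> : z + w j *: (v j - z) = (1 - w j) *: z + w j *: v j.
    by rewrite scalerBr scalerBl scale1r addrA addrAC.
  apply: smp => [|j']; first by rewrite subrK.
  by rewrite addr_ge0// mulr_ge0// ?subr_ge0// ler0n.
- have -> : z - w j *: (v j - z) = (1 + w j) *: z + (- w j) *: v j.
    by rewrite scalerBr scalerDl scale1r opprB scaleNr addrA.
  apply: smp => [|j']; first by rewrite addrK.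
  by case: eqP => [->|_] /=; rewrite ?mulr1 ?mulr0; have := w0 j'; have := w0 j; nra.
Qed.

Lemma convex_hull_symmetric n (X : set 'cV[R]_n) z d t :
  convex_hull X (z + d) -> convex_hull X (z - d) -> `|t| <= 1 ->
  convex_hull X (z + t *: d).
Proof.
move=> zpd zmd t1; have := ler_normlP _ _ t1 => -[tN tP].
have -> : z + t *: d =
    ((1 + t) / 2) *: (z + d) + (1 - (1 + t) / 2) *: (z - d).
  by apply/matrixP => i j; rewrite !mxE; field.
by apply: convex_hull_segment => //; apply/andP; split; lra.
Qed.

End ConvexHull.

(** * Hulls of bounded mixed-integer sets *)

Section MixedIntegerHull.
Variables (R : realType) (p q : nat).
Variables (m : nat) (G : 'M[R]_(m, p + q)) (h : 'cV[R]_m) (B : R).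
Let P : set 'cV[R]_(p + q) := [set x | vle (G *m x) h].
Let X := mixed_integer_points P.
Hypothesis P_bounded : forall x, P x -> forall j, `|x j 0| <= B.
Implicit Types x d : 'cV[R]_(p + q).

Definition active x : {set 'I_m} := [set r | (G *m x) r 0 == h r 0].

(** Directions along which the integer part and the active constraints of [x]
    are preserved. *)
Definition feasible_direction x d :=
  usubmx d = 0 /\ forall r, r \in active x -> (G *m d) r 0 = 0.

Let ray_mx x d (t : R) r : (G *m (x + t *: d)) r 0 = (G *m x) r 0 + t * (G *m d) r 0.
Proof. by rewrite mulmxDr -scalemxAr mxE [X in _ + X]mxE. Qed.

(** By boundedness the ray must leave [P]; at the exit point one more constraint
    is active. *)
Lemma ray_hits_face x d : X x -> d != 0 -> feasible_direction x d ->
  exists t, [/\ 0 < t, X (x + t *: d) & active x \proper active (x + t *: d)].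
Proof.
move=> [Px xint] d0 [du dact].
have [j dj0] : exists j, d j 0 != 0.
  apply/not_existsP => h'; move/eqP: d0; apply; apply/colP => j; rewrite mxE.
  by apply/eqP/negPn/negP => /h'.
have B0 : 0 <= B by exact: le_trans (P_bounded Px j).
have [r0 r0P] : exists r, 0 < (G *m d) r 0.
  apply/not_existsP => h'.
  (* A step of length 2 * B + 1 in coordinate j leaves the box of radius B. *)
  have Pt : P (x + ((2 * B + 1) / `|d j 0|) *: d).
    move=> r; rewrite ray_mx (le_trans _ (Px r))// gerDl mulr_ge0_le0//.
      by rewrite divr_ge0// addr_ge0// mulr_ge0.
    by rewrite leNgt; apply/negP/h'.
  have := P_bounded Pt j; rewrite !mxE => xt.
  have := P_bounded Px j; rewrite leNgt => /negP; apply.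
  have : `|(2 * B + 1) / `|d j 0| * d j 0| <= B + `|x j 0|.
    rewrite -(addrK (x j 0) (_ * d j 0)) (le_trans (ler_normB _ _))//.
    by rewrite lerD2r addrC.
  rewrite normrM normrM normfV normr_id divfK ?normr_eq0// ger0_norm; last lra.
  by move=> ?; lra.
pose slack r := (h r 0 - (G *m x) r 0) / (G *m d) r 0.
case: (Order.TotalTheory.arg_minP (P := fun r => 0 < (G *m d) r 0) slack r0P).
move=> r rP rmin {r0 r0P}.
have slackE : slack r * (G *m d) r 0 = h r 0 - (G *m x) r 0.
  by rewrite divfK// gt_eqF.
have xr : (G *m x) r 0 < h r 0.
  rewrite lt_neqAle Px andbT; apply/negP => hr.
  by have := rP; rewrite dact ?ltxx// inE.
exists (slack r); split.
- by rewrite divr_gt0// subr_gt0.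
- split=> [r'|k]; last by rewrite linearD linearZ/= du scaler0 addr0.
  rewrite ray_mx; have [r'0|r'0] := ltP 0 ((G *m d) r' 0).
    by have := rmin _ r'0; rewrite {2}/slack ler_pdivlMr// lerBrDl.
  rewrite (le_trans _ (Px r'))// gerDl mulr_ge0_le0// ltW// divr_gt0//.
  by rewrite subr_gt0.
- apply/properP; split.
    by apply/fintype.subsetP => r' r'A; move: (r'A); rewrite !inE ray_mx dact// mulr0 addr0.
  by exists r; rewrite inE ?ray_mx ?slackE ?subrKC ?eqxx// lt_eqF.
Qed.

(** Points of [X] that cannot be moved within their face while keeping their
    integer part. *)
Definition mixed_vertex x :=
  X x /\ forall d, feasible_direction x d -> d = 0.

Definition int_code x : {ffun 'I_p -> 'I_(2 * Num.bound B).+1} :=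
  [ffun j => inord (absz (Num.floor (usubmx x j 0) + (Num.bound B)%:Z))].

Lemma int_code_inj x x' : X x -> X x' -> int_code x = int_code x' ->
  usubmx x = usubmx x'.
Proof.
move=> [Px xint] [Px' x'int] /ffunP xx'; apply/colP => j.
have bnd y : P y -> usubmx y j 0 \is a Num.int ->
    0 <= Num.floor (usubmx y j 0) + (Num.bound B)%:Z <= (2 * Num.bound B)%:Z.
  move=> Py yint; have := P_bounded Py (lshift q j).
  have -> : y (lshift q j) 0 = usubmx y j 0 by rewrite mxE.
  move=> yB; have B0 : 0 <= B by exact: le_trans yB.
  have := archi_boundP B0; move: yB; rewrite -{1}(floorK yint).
  rewrite ler_norml => /andP[yB yB'] BB.
  have le1 : - (Num.bound B)%:Z <= Num.floor (usubmx y j 0).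
    by rewrite -(ler_int R) rmorphN/= (le_trans _ yB)// lerN2 ltW.
  have le2 : Num.floor (usubmx y j 0) <= (Num.bound B)%:Z.
    by rewrite -(ler_int R) (le_trans yB')// ltW.
  by rewrite mul2n -addnn PoszD; lia.
have := xx' j; rewrite !ffunE => /(congr1 val)/=.
have /andP[a1 a2] := bnd _ Px (xint j); have /andP[b1 b2] := bnd _ Px' (x'int j).
have absle (z : int) : 0 <= z -> z <= (2 * Num.bound B)%:Z ->
  (`|z|%N < (2 * Num.bound B).+1)%N by lia.
rewrite !inordK ?absle// => zz'.
rewrite -[LHS](floorK (xint j)) -[RHS](floorK (x'int j)); congr (_%:~R); lia.
Qed.

Lemma mixed_vertex_inj x x' : mixed_vertex x -> mixed_vertex x' ->
  active x = active x' -> int_code x = int_code x' -> x = x'.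
Proof.
move=> [Xx xv] [Xx' _] aa cc; apply/eqP; rewrite -subr_eq0; apply/eqP/xv.
split; first by rewrite linearB/= (int_code_inj Xx Xx' cc) subrr.
move=> r rx; have rx' : r \in active x' by rewrite -aa.
move: rx rx'; rewrite !inE => /eqP xr /eqP x'r.
by rewrite mulmxBr mxE xr mxE x'r subrr.
Qed.

(** A point that is not a mixed vertex lies between two points with more active
    constraints, hence by induction in the hull of the mixed vertices; these are
    finitely many, each being determined by its active constraints and its
    integer part. *)
Lemma mixed_integer_finite_hull : X !=set0 ->
  exists (K : finType) (V : K -> 'cV[R]_(p + q)),
    (forall k, X (V k)) /\ X `<=` finite_hull V.
Proof.
move=> [x0 Xx0].
pose code x := (active x, int_code x).
(* The default value keeps every V k in X, as the hull must be spanned by X. *)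
pose V k := if pselect (exists x, mixed_vertex x /\ code x = k) is left ex
            then projT1 (cid ex) else x0.
exists ({set 'I_m} * {ffun 'I_p -> 'I_(2 * Num.bound B).+1})%type, V; split.
  by move=> k; rewrite /V; case: pselect => // ex; have [[]] := projT2 (cid ex).
have VK x : mixed_vertex x -> V (code x) = x.
  move=> xv; rewrite /V; case: pselect => [ex|]; last by case; exists x.
  by have [xv' [? ?]] := projT2 (cid ex); apply: mixed_vertex_inj.
move=> x; have [k] := ubnP #|~: active x|; elim: k x => // k IH x.
rewrite ltnS => xk Xx.
have [xv|/existsNP[d /not_implyP[dx /eqP d0]]] :=
    pselect (forall d, feasible_direction x d -> d = 0).
  by rewrite -(VK x)//; exact: finite_hull_vertex.
have dNx : feasible_direction x (- d).
  split; first by rewrite linearN/= dx.1 oppr0.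
  by move=> r rx; rewrite mulmxN mxE dx.2// oppr0.
have dN0 : - d != 0 by rewrite oppr_eq0.
have IHx y : X y -> active x \proper active y -> finite_hull V y.
  move=> Xy xy; apply: IH => //; apply: leq_trans xk.
  by apply: proper_card; rewrite finset.properC.
have [t [t0 Xt xt]] := ray_hits_face Xx d0 dx.
have [t' [t'0 Xt' xt']] := ray_hits_face Xx dN0 dNx.
have -> : x = (t' / (t + t')) *: (x + t *: d) +
              (1 - t' / (t + t')) *: (x + t' *: (- d)).
  by apply/matrixP => i j; rewrite !mxE; field; rewrite gt_eqF// addr_gt0.
apply: finite_hull_segment; [|exact: IHx..].
have tt' : 0 < t + t' by exact: addr_gt0.
apply/andP; split; first by rewrite divr_ge0// ltW.
by rewrite ler_pdivrMr// mul1r lerDr ltW.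
Qed.

End MixedIntegerHull.

Lemma compact_coord_bounded (R : realType) n (P : set 'cV[R]_n) : compact P ->
  exists B, forall x, P x -> forall j, `|x j 0| <= B.
Proof.
move=> cP.
have bj (j : 'I_n) : exists B, forall x, P x -> `|x j 0| <= B.
  have : compact ((fun x : 'cV[R]_n => x j 0) @` P).
    apply: continuous_compact cP; apply: continuous_subspaceT.
    exact: coord_continuous.
  move=> /compact_bounded/pinfty_ex_gt0[B _ PB].
  by exists B => x Px; apply: PB; exists x.
have [b bP] := choice bj; exists (\sum_j `|b j|) => x Px j.
rewrite (le_trans (bP j x Px))// (bigD1 j)//= (le_trans (ler_norm _))// lerDl.
exact: sumr_ge0.
Qed.

(** * Limits along ultrafilters and attained minima *)

Section UltraLimits.
Variables (R : realType) (G : set_system nat).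
Hypothesis GU : UltraFilter G.

Lemma ultra_bounded_cvg (u : nat -> R) B :
  (forall k, `|u k| <= B) -> exists l : R, u k @[k --> G] --> l.
Proof.
move=> uB.
have uU : UltraFilter (u @ G).
  split=> [|H HF GH]; first exact: fmap_proper_filter.
  rewrite eqEsubset; split=> // C HC.
  have [//|GnC] := in_ultra_setVsetC (u @^-1` C) GU.
  have [] := filter_not_empty H.
  rewrite -(setICr C); apply: filterI; first exact: HC.
  exact: GH.
have := @segment_compact R (- B) B; rewrite compact_ultra => /(_ _ uU)[].
  suff : G (u @^-1` `[- B, B]) by [].
  by apply: filterE => k /=; rewrite in_itv/= -ler_norml uB.
by move=> l [_ ul]; exists l.
Qed.

(** Two terms within 1/2 of the limit coincide; if they differed from the limit,
    a closer term would be a different integer at distance less than 1. *)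
Lemma cvg_int (u : nat -> R) (l : R) :
  (forall k, u k \is a Num.int) -> u k @[k --> G] --> l -> l \is a Num.int.
Proof.
move=> uint ul.
have near eps : 0 < eps -> exists k, `|l - u k| < eps.
  move=> eps0; have : \forall k \near G, `|l - u k| < eps by exact: cvgr_dist_lt.
  exact: filter_ex.
have [k kl] := near (1 / 2) ltac:(lra).
have [->//|lk] := eqVneq l (u k).
have lk0 : 0 < `|l - u k| by rewrite normr_gt0 subr_eq0.
have [j jl] := near _ lk0.
have : 1 <= `|u k - u j|.
  apply: norm_intr_ge1; first exact: rpredB.
  by rewrite subr_eq0; apply/eqP => kj; rewrite kj ltxx in jl.
have -> : u k - u j = (l - u j) - (l - u k) by ring.
by have := ler_normB (l - u j) (l - u k); lra.
Qed.

Lemma cvg_sumr (I : finType) (f : I -> nat -> R) (l : I -> R) :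
  (forall i, f i k @[k --> G] --> l i) ->
  \sum_i f i k @[k --> G] --> \sum_i l i.
Proof. by move=> fl; apply: cvg_big => //; exact: add_continuous. Qed.

Lemma cvg_mulmx_coord n (x_ : nat -> 'cV[R]_n) (x : 'cV[R]_n) m (B : 'M[R]_(m, n)) s :
  (forall j, x_ k j 0 @[k --> G] --> x j 0) ->
  (B *m x_ k) s 0 @[k --> G] --> (B *m x) s 0.
Proof.
move=> xj; rewrite mxE.
under eq_fun do rewrite mxE.
apply: cvg_sumr => j.
by apply: cvgMr; exact: xj.
Qed.

End UltraLimits.

(** Compactness in coordinates: along an ultrafilter, every sequence of points of
    [X] converges to a point of [X]. *)
Definition ultra_closed (R : realType) n (X : set 'cV[R]_n) :=
  forall (G : set_system nat) (x_ : nat -> 'cV[R]_n),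
    UltraFilter G -> (forall k, X (x_ k)) ->
    exists2 x, X x & forall j, x_ k j 0 @[k --> G] --> x j 0.

Lemma mixed_integer_ultra_closed (R : realType) p q (P : set 'cV[R]_(p + q)) :
  polyhedron P -> compact P -> ultra_closed (mixed_integer_points P).
Proof.
move=> [m [H [h PE]]] /compact_coord_bounded[B PB] G x_ GU xX.
have /choice[l xl] (j : 'I_(p + q)) : exists l : R, x_ k j 0 @[k --> G] --> l.
  by apply: (@ultra_bounded_cvg _ _ _ _ B) => k; apply: PB; exact: (xX k).1.
exists (\col_j l j); last by move=> j; rewrite mxE.
split=> [|j].
  rewrite PE => s; apply: (cvgr_to_le (f := fun k => (H *m x_ k) s 0) (F := G)).
    by apply: cvg_mulmx_coord => j; rewrite mxE.
  by apply: filterE => k; have := (xX k).1; rewrite {1}PE; exact.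
rewrite !mxE; apply: (cvg_int GU (u := fun k => x_ k (lshift q j) 0)); last exact: xl.
by move=> k; have := (xX k).2 j; rewrite mxE.
Qed.

(** The hypothesis on [F] says that [F] is a finite maximum of affine functions,
    which is all that is needed to pass to the limit in a minimizing sequence;
    [rho_max] is such a minimum. *)
Lemma ultra_closed_min_max (R : realType) n (X : set 'cV[R]_n)
    m (B : 'M[R]_(m, n)) (l : 'cV[R]_m) (F : 'cV[R]_n -> R) (b : R) :
  ultra_closed X -> X !=set0 -> (forall x, X x -> b <= F x) ->
  (forall x r, F x <= r <-> vle (B *m x - l) (const_mx r)) ->
  exists2 x, X x & forall x', X x' -> F x <= F x'.
Proof.
move=> Xc [x0 Xx0] Fb FE.
pose E := [set F x | x in X].
have Elb : has_lbound E by exists b => _ [x Xx <-]; exact: Fb.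
have Einf : has_inf E by split=> //; exists (F x0), x0.
have /choice[x_ x_P] k : exists x, X x /\ F x < inf E + harmonic k.
  have [_ [x Xx <-] Fx] := inf_adherent (harmonic_gt0 k : 0 < harmonic k :> R) Einf.
  by exists x.
have [G [GU ooG]] := ultraFilterLemma (eventually_filter : ProperFilter \oo).
have [x Xx x_x] := Xc G x_ GU (fun k => (x_P k).1).
exists x => // x' Xx'; rewrite (@le_trans _ _ (inf E))//; last first.
  by apply: ge_inf => //; exists x'.
apply/FE => s; rewrite [leRHS]mxE.
have Blim : (B *m x_ k) s 0 - l s 0 - harmonic k @[k --> G] --> (B *m x) s 0 - l s 0 - 0.
  apply: cvgB; first by apply: cvgB; [exact: cvg_mulmx_coord|exact: cvg_cst].
  apply: cvg_trans cvg_harmonic; exact: cvg_fmap2.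
rewrite subr0 in Blim; rewrite !mxE; rewrite !mxE in Blim.
apply: (cvgr_to_le Blim); apply: filterE => k.
rewrite lerBlDr; have /FE/(_ s) := ltW (x_P k).2.
by rewrite !mxE.
Qed.

(** * Resource use of lexicographic solutions *)

Section Extrema.
Variable R : realType.
Implicit Type E : set R.

Lemma setminP E r : minimums E r -> minimums E (setmin E).
Proof. by move=> Er; apply: xgetPex; exists r. Qed.

Lemma setmaxP E r : maximums E r -> maximums E (setmax E).
Proof. by move=> Er; apply: xgetPex; exists r. Qed.

Lemma setmax_range (I : finType) (f : I -> R) : (0 < #|I|)%N ->
  maximums (range f) (setmax (range f)).
Proof.
move=> /card_gt0P[i0 _].
case: (Order.TotalTheory.arg_maxP (P := xpredT) f (erefl : xpredT i0)) => i _ imax.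
apply: (@setmaxP _ (f i)); split; first by exists i.
by move=> _ [j _ <-]; exact: imax.
Qed.

Lemma setmax_range_le (I : finType) (f : I -> R) r : (0 < #|I|)%N ->
  setmax (range f) <= r <-> forall i, f i <= r.
Proof.
move=> /setmax_range-/(_ f)[[i _ fi] fmax]; split=> [fr j|]; last by rewrite -fi.
by rewrite (le_trans _ fr)//; apply: fmax; exists j.
Qed.

End Extrema.

Section AgentExtrema.
Variables (R : realType) (S n : nat) (A : 'M[R]_(S, n)) (X : set 'cV[R]_n) (B : R).
Hypotheses (S_gt0 : (0 < S)%N) (Xc : ultra_closed X) (X0 : X !=set0).
Hypothesis X_bounded : forall x, X x -> forall j, `|x j 0| <= B.

Let L := lower_resource A X.

Lemma mulmx_bounded m (C : 'M[R]_(m, n)) s x : X x ->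
  `|(C *m x) s 0| <= \sum_j `|C s j| * B.
Proof.
move=> Xx; rewrite mxE (le_trans (ler_norm_sum _ _ _))//; apply: ler_sum => j _.
by rewrite normrM ler_wpM2l// X_bounded.
Qed.

Lemma affine_min m (C : 'M[R]_(m, n)) s : exists2 x, X x &
  forall x', X x' -> (C *m x) s 0 <= (C *m x') s 0.
Proof.
apply: (@ultra_closed_min_max _ _ X _ (row s C) 0 _ (- \sum_j `|C s j| * B)) => //.
  by move=> x Xx; have := mulmx_bounded C s Xx; rewrite ler_norml => /andP[].
move=> x r; rewrite subr0 -row_mul; split=> [xr i|/(_ 0)]; last by rewrite !mxE.
by move: xr; rewrite !mxE.
Qed.

Lemma affine_min_setmin m (C : 'M[R]_(m, n)) s :
  minimums [set (C *m x) s 0 | x in X] (setmin [set (C *m x) s 0 | x in X]).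
Proof.
have [x Xx xmin] := affine_min C s; apply: (@setminP _ _ ((C *m x) s 0)).
by split; [exists x|move=> _ [x' Xx' <-]; exact: xmin].
Qed.

Lemma lower_resource_le x s : X x -> L s 0 <= (A *m x) s 0.
Proof.
move=> Xx; rewrite /L mxE.
by apply: (affine_min_setmin A s).2; exists x.
Qed.

Let excess x := setmax (range (fun s : 'I_S => (A *m x - L) s 0)).

Lemma rho_maxP : exists2 x, X x & forall s, (A *m x) s 0 <= L s 0 + rho_max A X.
Proof.
have excessP x r : excess x <= r <-> vle (A *m x - L) (const_mx r).
  rewrite /excess setmax_range_le ?card_ord//.
  by split=> h s; [rewrite [leRHS]mxE; exact: h
                  |have := h s; rewrite [leRHS]mxE].
have excess_ge0 x : X x -> 0 <= excess x.
  move=> Xx; have s0 : 'I_S by exact: Ordinal S_gt0.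
  have /excessP/(_ s0) := lexx (excess x); rewrite [leRHS]mxE; apply: le_trans.
  by rewrite sub_coord subr_ge0 lower_resource_le.
have [x Xx xmin] := ultra_closed_min_max Xc X0 excess_ge0 excessP.
have [[x' Xx' rhoE] _] : minimums [set excess x | x in X] (rho_max A X).
  apply: (@setminP _ _ (excess x)).
  by split; [exists x|move=> _ [x' Xx' <-]; exact: xmin].
exists x' => // s; have /excessP/(_ s) := lexx (excess x').
by rewrite rhoE sub_coord [leRHS]mxE lerBlDl.
Qed.

Lemma rho_max_ge0 : 0 <= rho_max A X.
Proof.
have [x Xx xrho] := rho_maxP; have s0 : 'I_S by exact: Ordinal S_gt0.
by have := xrho s0; have := lower_resource_le s0 Xx; lra.
Qed.

Lemma le_sigma_loc x s r : X x -> r <= rho_max A X -> L s 0 + r <= (A *m x) s 0 ->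
  r <= sigma_loc A X s 0.
Proof.
move=> Xx rrho rx; rewrite /sigma_loc mxE le_min rrho/=.
have [y Xy ymax] := affine_min (- A) s.
have [_] : maximums [set (A *m x - L) s 0 | x in X]
    (setmax [set (A *m x - L) s 0 | x in X]).
  apply: (@setmaxP _ _ ((A *m y - L) s 0)); split; first by exists y.
  move=> _ [x' Xx' <-]; have := ymax _ Xx'.
  by rewrite !mulNmx mxE [leRHS]mxE lerN2 !sub_coord lerD2r.
move=> /(_ ((A *m x - L) s 0) (ex_intro2 _ _ x Xx erefl)); apply: le_trans.
by rewrite sub_coord lerBrDl.
Qed.

Lemma sigma_loc_ge0 s : 0 <= sigma_loc A X s 0.
Proof.
have [x Xx] := X0; apply: (le_sigma_loc Xx rho_max_ge0).
by rewrite addr0 lower_resource_le.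
Qed.

(** When a point [z] of the hull complies with [y] up to [r], the smallest
    resource use [L] is at most [y + r]. The point realizing [rho_max] then bounds
    the violation of a lexicographic solution by [r + rho_max], while no point of
    [X] uses more than [L] plus the largest excess over [L]; [sigma_loc] is the
    smaller of the two excesses. *)
Lemma lex_resource c y x z r s : lex_solution c A X y x ->
  convex_hull X z -> 0 <= r -> vle (A *m z) (y + const_mx r) ->
  (A *m x) s 0 <= y s 0 + r + sigma_loc A X s 0.
Proof.
move=> [rho [xi [[cx Ax Xx rho0] opt]]] Xz r0 Az.
have Lz s' : L s' 0 <= y s' 0 + r.
  have := Az s'; rewrite shift_coord; apply: le_trans.
  by apply: convex_hull_lin_ge Xz => x' Xx'; exact: lower_resource_le.
have [x' Xx' xrho] := rho_maxP.
have rhoP : rho <= r + rho_max A X.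
  have : lex_feasible c A X y (r + rho_max A X) (dot c x') x'.
    split=> //; last by rewrite addr_ge0// rho_max_ge0.
    move=> s'; rewrite shift_coord (le_trans (xrho s'))//.
    by have := Lz s'; lra.
  by move=> /opt[/ltW//|[-> _]].
have := Ax s; rewrite shift_coord => Axs.
rewrite -lerBlDl; have [neg|pos] := ltP ((A *m x) s 0 - (y s 0 + r)) 0.
  by rewrite ltW// (lt_le_trans neg)// sigma_loc_ge0.
apply: (le_sigma_loc Xx); first lra.
by have := Lz s; lra.
Qed.

Lemma lex_resource_integral c y x z r s : lex_solution c A X y x ->
  X z -> 0 <= r -> vle (A *m z) (y + const_mx r) ->
  (A *m x) s 0 <= y s 0 + r.
Proof.
move=> [rho [xi [[cx Ax Xx rho0] opt]]] Xz r0 Az.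
have rhor : rho <= r.
  have : lex_feasible c A X y r (dot c z) z by split.
  by move=> /opt[/ltW//|[-> _]].
by have := Ax s; rewrite shift_coord; lra.
Qed.

End AgentExtrema.

(** * Fractional agents at a unique optimum *)

Section LinearProgram.
Variables (R : realType) (N S : nat) (n : 'I_N -> nat).
Variables (c : forall i, 'cV[R]_(n i)) (A : forall i, 'M[R]_(S, n i)).
Variables (X : forall i, set 'cV[R]_(n i)) (b sigma : 'cV[R]_S).
Arguments X : clear implicits.
Implicit Types z : forall i, 'cV[R]_(n i).

(** If more than [S] components of the optimum were fractional, their
    perturbations would be linearly dependent in the resource space: moving
    along the dependency, both ways, would keep the point feasible and
    therefore optimal. *)
Lemma unique_optimum_few_fractional z : lp_optimal c A X b sigma z ->
  (forall z', lp_optimal c A X b sigma z' -> z' = z) ->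
  (#|[set i | ~~ `[< X i (z i) >]]%SET| <= S)%N.
Proof.
move=> zopt zuniq; have [[zX zb] zmin] := zopt.
set F := [set i | _]%SET; rewrite leqNgt; apply/negP => SF.
have ex_d i : exists d, [/\ convex_hull (X i) (z i + d), convex_hull (X i) (z i - d)
    & i \in F -> d != 0].
  case: (boolP (i \in F)) => [iF|_]; last first.
    by exists 0; rewrite subr0 addr0; split.
  have nX : ~ X i (z i) by move: iF; rewrite inE => /asboolPn.
  by have [d [d0 zd zd']] := convex_hull_not_extreme (zX i) nX; exists d.
pose d i := projT1 (cid (ex_d i)).
have dP i : [/\ convex_hull (X i) (z i + d i), convex_hull (X i) (z i - d i)
    & i \in F -> d i != 0] by exact: projT2 (cid (ex_d i)).
pose D : 'M[R]_(#|F|, S) := \matrix_k (A (enum_val k) *m d (enum_val k))^T.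
have [tau tau0 tauD] : exists2 tau : 'rV[R]_#|F|, tau != 0 & tau *m D = 0.
  have : kermx D != 0.
    rewrite -mxrank_eq0 mxrank_ker -lt0n subn_gt0.
    exact: leq_ltn_trans (rank_leq_col D) SF.
  by move=> /rowV0Pn[v /sub_kermxP vD v0]; exists v.
pose T := \sum_k `|tau 0 k|.
have T0 : 0 < T.
  rewrite lt_neqAle sumr_ge0// andbT eq_sym; apply: contra tau0.
  rewrite psumr_eq0// => /allP h; apply/eqP/rowP => k; rewrite mxE.
  by apply/eqP; have := h k (mem_index_enum k); rewrite normr_eq0.
pose t i := T^-1 * \sum_k (enum_val k == i)%:R * tau 0 k.
have t_le1 i : `|t i| <= 1.
  rewrite normrM gtr0_norm ?invr_gt0// mulrC ler_pdivrMr// mul1r.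
  rewrite (le_trans (ler_norm_sum _ _ _))//; apply: ler_sum => k _.
  by rewrite normrM; case: eqP; rewrite ?normr1 ?mul1r// normr0 mul0r.
have tE k : t (enum_val k) = T^-1 * tau 0 k.
  rewrite /t (bigD1 k)//= eqxx mul1r big1 ?addr0// => k' kk'.
  by rewrite (inj_eq enum_val_inj) (negbTE kk') mul0r.
have tA : \sum_i t i *: (A i *m d i) = 0.
  have : T^-1 *: (tau *m D)^T = 0 by rewrite tauD trmx0 scaler0.
  apply: etrans; apply/colP => s; rewrite summxE !mxE mulr_sumr.
  under eq_bigr do rewrite mxE /t mulr_sumr mulr_suml.
  rewrite exchange_big/=; apply: eq_bigr => k _.
  rewrite (bigD1 (enum_val k))//= eqxx mul1r big1 ?addr0; last first.
    by move=> i; rewrite eq_sym => /negbTE ->; rewrite mul0r mulr0 mul0r.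
  by rewrite mulrA !mxE.
pose z_ a i := z i + (a * t i) *: d i.
have feas a : `|a| <= 1 -> lp_feasible A X b sigma (z_ a).
  move=> a1; split=> [i|].
    have [zpd zmd _] := dP i; apply: convex_hull_symmetric => //.
    by rewrite normrM mulr_ile1.
  have -> : \sum_i A i *m z_ a i = \sum_i A i *m z i + a *: \sum_i t i *: (A i *m d i).
    rewrite scaler_sumr -big_split/=; apply: eq_bigr => i _.
    by rewrite mulmxDr -scalemxAr scalerA.
  by rewrite tA scaler0 addr0.
have costE a : total_cost c (z_ a) =
    total_cost c z + a * \sum_i t i * dot (c i) (d i).
  rewrite /total_cost mulr_sumr -big_split/=; apply: eq_bigr => i _.
  by rewrite dot_line mulrA.
have f1 : lp_feasible A X b sigma (z_ 1) by apply: feas; rewrite normr1.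
have fN1 : lp_feasible A X b sigma (z_ (-1)) by apply: feas; rewrite normrN1.
have : z_ 1 = z.
  apply: zuniq; split=> // z' /zmin; apply: le_trans.
  have := zmin _ fN1; rewrite !costE; lra.
have [k tauk] : exists k, tau 0 k != 0.
  by move: tau0 => /eqP/rowP; move=> /existsNP[k]; rewrite mxE => /eqP; exists k.
move=> /(congr1 (fun z' => z' (enum_val k) - z (enum_val k))).
rewrite /z_ subrr addrC addKr mul1r tE => /eqP.
rewrite scaler_eq0 mulf_eq0 (negbTE tauk) orbF invr_eq0 gt_eqF//=.
by have [_ _ /(_ (enum_valP k)) /negbTE ->] := dP (enum_val k).
Qed.

End LinearProgram.

(** * Exactness of the penalty *)

Section ExactPenalty.
Variables (R : realType) (N S : nat) (n : 'I_N -> nat).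
Variables (c : forall i, 'cV[R]_(n i)) (A : forall i, 'M[R]_(S, n i)).
Variables (X : forall i, set 'cV[R]_(n i)) (b sigma : 'cV[R]_S).
Arguments X : clear implicits.
Variables (K : 'I_N -> finType) (V : forall i, K i -> 'cV[R]_(n i)).
Arguments V : clear implicits.
Hypotheses (VX : forall i k, X i (V i k)).
Hypothesis XV : forall i, X i `<=` finite_hull (V i).
Implicit Types z : forall i, 'cV[R]_(n i).

(** The multiplier solves one linear inequality per tuple of vertices. If this
    system were unsolvable, averaging the tuples with the weights of the
    certificate of [farkas] would give a feasible point of smaller cost. *)
Lemma lp_multiplier zopt : lp_optimal c A X b sigma zopt ->
  exists2 nu : 'cV[R]_S, vle 0 nu &
    forall z, (forall i, convex_hull (X i) (z i)) ->
    total_cost c zopt <= total_cost c z + dot nu (\sum_i A i *m z i - (b - sigma)).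
Proof.
move=> [[zX zb] zmin]; pose f := total_cost c zopt.
pose T : finType := {dffun forall i, K i}.
pose pt (k : T) i := V i (k i).
pose res z := \sum_i A i *m z i - (b - sigma).
have [[nu nuP]|[w [w0 wg wh]]] := @farkas R S (T + 'I_S)%type
  (fun k s => match k with inl k => res (pt k) s 0 | inr s' => (s == s')%:R end)
  (fun k => match k with inl k => total_cost c (pt k) - f | inr _ => 0 end).
  exists (\col_s nu s) => [s|z zhull].
    have := nuP (inr s); rewrite addr0 (bigD1 s)//= eqxx mul1r big1 ?addr0.
      by rewrite !mxE.
    by move=> s' /negbTE ->; rewrite mul0r.
  set u := \col_s nu s.
  pose B i := (c i)^T + u^T *m A i.
  have BE i (x : 'cV[R]_(n i)) : (B i *m x) 0 0 = dot (c i) x + dot u (A i *m x).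
    by rewrite /B mulmxDl mxE /dot mulmxA.
  have lagrE z' : total_cost c z' + dot u (res z') =
      \sum_i (B i *m z' i) 0 0 - dot u (b - sigma).
    rewrite /res (dotDr u (\sum_i A i *m z' i)) (dotNr u (b - sigma)).
    rewrite dot_sumr addrA /total_cost -big_split/=.
    by congr (_ - _); apply: eq_bigr => i _; rewrite BE.
  have minV i : exists k, forall k', (B i *m V i k) 0 0 <= (B i *m V i k') 0 0.
    have [w [w0 w1] _] : finite_hull (V i) (z i).
      exact: (sub_finite_hull (@XV i)).
    have [k0 _] : exists k0 : K i, True.
      apply/not_existsP => h; move: w1; rewrite big1 => [/eqP|k]; last by case: (h k).
      by rewrite eq_sym oner_eq0.
    case: (Order.TotalTheory.arg_minP (P := xpredT) (fun k => (B i *m V i k) 0 0)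
      (erefl : xpredT k0)) => k _ kmin.
    by exists k => k'; exact: kmin.
  pose k : T := [ffun i => projT1 (cid (minV i))].
  have := nuP (inl k); rewrite -/f.
  have -> : \sum_i res (pt k) i 0 * nu i = dot u (res (pt k)).
    by rewrite dotE; apply: eq_bigr => s _; rewrite [u s 0]mxE mulrC.
  move=> h; have {h} : f <= total_cost c (pt k) + dot u (res (pt k)) by lra.
  move=> /le_trans; apply.
  rewrite !lagrE lerD2r; apply: ler_sum => i _.
  apply: (finite_hull_lin_ge (V := V i)) => [k'|].
    by rewrite /pt ffunE; apply: (projT2 (cid (minV i))). 
  exact: (sub_finite_hull (@XV i)).
pose W := \sum_k w (inl k).
have W0 : 0 < W.
  rewrite lt_neqAle sumr_ge0// andbT eq_sym; apply/negP.
  rewrite psumr_eq0// => /allP h; have wl k : w (inl k) = 0.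
    by apply/eqP/h; rewrite mem_index_enum.
  move: wh; rewrite big_sumType/= !big1 ?addr0 ?ltxx// => k _; rewrite ?mulr0//.
  by rewrite wl mul0r.
pose w' k := w (inl k) / W.
have w's : simplex w'.
  by split=> [k|]; [rewrite divr_ge0// ltW|rewrite -mulr_suml divff// gt_eqF].
pose z i := \sum_k w' k *: pt k i.
have resz : res z = W^-1 *: \sum_k w (inl k) *: res (pt k).
  have -> : res z = \sum_k w' k *: \sum_i A i *m pt k i - \sum_k w' k *: (b - sigma).
    rewrite -scaler_suml w's.2 scale1r; congr (_ - _).
    under [RHS]eq_bigr do rewrite scaler_sumr.
    rewrite exchange_big/=; apply: eq_bigr => i _.
    by rewrite mulmx_sumr; apply: eq_bigr => k _; rewrite scalemxAr.
  rewrite -sumrB scaler_sumr; apply: eq_bigr => k _.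
  by rewrite -scalerBr scalerA mulrC.
have costz : total_cost c z = f + W^-1 * \sum_k w (inl k) * (total_cost c (pt k) - f).
  transitivity (\sum_k w' k * total_cost c (pt k)).
    rewrite /total_cost; under [LHS]eq_bigr do rewrite dot_sumr.
    rewrite exchange_big/=; apply: eq_bigr => k _; rewrite mulr_sumr.
    by apply: eq_bigr => i _; rewrite dotZr.
  rewrite mulr_sumr -{1}[f]mul1r -w's.2 mulr_suml -big_split/=.
  by apply: eq_bigr => k _; rewrite /w'; ring.
have : f <= total_cost c z.
  apply: zmin; split=> [i|s].
    by apply: (convex_hull_finite (V := fun k => pt k i)) => // k; exact: VX.
  rewrite -subr_ge0 -oppr_le0 opprB.
  have -> : (\sum_i A i *m z i) s 0 - (b - sigma) s 0 = res z s 0.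
    by rewrite [RHS]mxE [in RHS]mxE.
  rewrite resz mxE summxE pmulr_rle0 ?invr_gt0//.
  under eq_bigr do rewrite mxE.
  have := wg s; rewrite big_sumType/= [X in _ + X](bigD1 s)//= eqxx mulr1.
  rewrite [X in _ + (_ + X)]big1 ?addr0.
    by move=> ws; have := w0 (inr s); lra.
  by move=> s'; rewrite eq_sym => /negbTE ->; rewrite mulr0.
rewrite costz lerDl pmulr_rge0 ?invr_gt0// leNgt.
by move: wh; rewrite big_sumType/= [X in _ + X]big1 ?addr0 => [->|k _]; rewrite ?mulr0.
Qed.

(** Violating the coupling constraints by [v] saves at most the sum of the
    multipliers per unit of [v], so that a larger penalty makes every violation
    unprofitable, by a margin of at least [v]. *)
Lemma exact_penalty zopt : lp_optimal c A X b sigma zopt ->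
  exists2 M0 : R, 0 < M0 & forall M, M0 <= M ->
    forall (y : 'I_N -> 'cV[R]_S) z (v : 'I_N -> R),
      \sum_i y i = b - sigma ->
      (forall i, loc_feasible (A i) (X i) (y i) (z i, v i)) ->
      total_cost c zopt + \sum_i v i <= \sum_i loc_cost (c i) M (z i, v i).
Proof.
move=> /lp_multiplier[nu nu0 nuP].
have nu_ge0 : 0 <= \sum_s nu s 0.
  by apply: sumr_ge0 => s _; have := nu0 s; rewrite mxE.
exists (\sum_s nu s 0 + 1); first lra.
move=> M MM0 y z v ysum zv.
have := nuP z (fun i => (zv i).1.1).
have res_le : vle (\sum_i A i *m z i - (b - sigma)) (const_mx (\sum_i v i)).
  move=> s; rewrite -ysum -sumrB summxE [leRHS]mxE; apply: ler_sum => i _.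
  have := (zv i).2 s; rewrite /= [leRHS]mxE [X in _ <= _ + X]mxE => Az.
  by rewrite mxE [X in _ + X]mxE lerBlDl.
have := dot_le nu0 res_le.
have -> : dot nu (const_mx (\sum_i v i)) = (\sum_s nu s 0) * \sum_i v i.
  by rewrite dotE mulr_suml; apply: eq_bigr => s _; rewrite mxE.
have -> : \sum_i loc_cost (c i) M (z i, v i) = total_cost c z + M * \sum_i v i.
  by rewrite /loc_cost/= big_split/= -mulr_sumr.
have v0 : 0 <= \sum_i v i by apply: sumr_ge0 => i _; exact: (zv i).1.2.
by nra.
Qed.

End ExactPenalty.

(** * Subgradient descent and the exchange of multipliers *)

Section DescentSequences.
Variables (R : realType) (alpha : nat -> R).
Let s := series (fun t => alpha t ^+ 2).
Hypothesis s_cvg : cvgn s.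

Let s_nd : nondecreasing_seq s.
Proof. by apply: nondecreasing_series => t _ _; exact: sqr_ge0. Qed.

Let s_lim n : s n <= limn s.
Proof. exact: nondecreasing_cvgn_le. Qed.

Lemma descent_telescope (E g : nat -> R) (C : R) T k :
  (forall t, (T <= t)%N -> E t.+1 <= E t - alpha t * g t + C * alpha t ^+ 2) ->
  E (T + k)%N <= E T - \sum_(T <= t < T + k) alpha t * g t + C * (s (T + k)%N - s T).
Proof.
move=> Estep; elim: k => [|k IH].
  by rewrite addn0 big_geq// subrr mulr0 addr0 subr0.
have := Estep (T + k)%N (leq_addr _ _).
have -> : s (T + k.+1)%N = s (T + k)%N + alpha (T + k)%N ^+ 2.
  by rewrite addnS /s !seriesEnat/= big_nat_recr.
by rewrite addnS big_nat_recr ?leq_addr//=; lra.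
Qed.

Lemma descent_le (E g : nat -> R) (C : R) T k : 0 <= C ->
  (forall t, 0 <= alpha t) -> (forall t, 0 <= g t) ->
  (forall t, E t.+1 <= E t - alpha t * g t + C * alpha t ^+ 2) ->
  E (T + k)%N <= E T + C * (limn s - s T).
Proof.
move=> C0 a0 g0 Estep; have := @descent_telescope E g C T k (fun t _ => Estep t).
have : 0 <= \sum_(T <= t < T + k) alpha t * g t.
  by apply: sumr_ge0 => t _; rewrite mulr_ge0.
by have := s_lim (T + k)%N; nra.
Qed.

(** If [g] stayed above [eta], the decrease of [E], at least [eta] times a
    divergent sum, would exhaust the initial value plus the finite total increase
    due to the squared steps. *)
Lemma descent_gap (E g : nat -> R) (C : R) : 0 <= C ->
  (forall t, 0 <= alpha t) -> series alpha @ \oo --> +oo ->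
  (forall t, 0 <= E t) ->
  (forall t, E t.+1 <= E t - alpha t * g t + C * alpha t ^+ 2) ->
  forall eta T, 0 < eta -> exists2 t, (T <= t)%N & g t < eta.
Proof.
move=> C0 a0 aoo E0 Estep eta T eta0; apply: contrapT => h.
have g_ge t : (T <= t)%N -> eta <= g t.
  by move=> Tt; rewrite leNgt; apply/negP => gt; apply: h; exists t.
pose D := (E T + C * (limn s - s T)) / eta + 1.
have : \forall n \near \oo, series alpha T + D <= series alpha n.
  by move/cvgryPge: aoo; apply.
case=> n0 _ n0P; have /= := n0P (T + n0)%N (leq_addl _ _).
have := @descent_telescope E g C T n0 (fun t _ => Estep t).
have -> : series alpha (T + n0)%N = series alpha T + \sum_(T <= t < T + n0) alpha t.
  by rewrite !seriesEnat/= -big_cat_nat// leq_addr.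
rewrite lerD2l; set a := \sum_(T <= t < T + n0) alpha t.
have : eta * a <= \sum_(T <= t < T + n0) alpha t * g t.
  rewrite mulr_sumr; apply: ler_sum_nat => t /andP[Tt _].
  by rewrite mulrC ler_wpM2l// g_ge.
have := E0 (T + n0)%N; have := s_lim (T + n0)%N.
have : D * eta = E T + C * (limn s - s T) + eta.
  by rewrite mulrDl mul1r divfK// gt_eqF.
set Dp := D; move=> DE ? ? ? ? Da.
have : D * eta <= a * eta by rewrite ler_wpM2r// ltW.
by nra.
Qed.

(** Once [E] is small, it can only increase by a tail of a convergent series. *)
Lemma descent_limit (E g : nat -> R) (C : R) : 0 <= C ->
  (forall t, 0 <= alpha t) -> (forall t, 0 <= g t) ->
  (forall t, E t.+1 <= E t - alpha t * g t + C * alpha t ^+ 2) ->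
  (forall eta T, 0 < eta -> exists2 t, (T <= t)%N & E t < eta) ->
  forall eta, 0 < eta -> exists T, forall t, (T <= t)%N -> E t < eta.
Proof.
move=> C0 a0 g0 Estep Einf eta eta0.
have tail0 : 0 < eta / (2 * (C + 1)) by rewrite divr_gt0// mulr_gt0//; lra.
have : \forall n \near \oo, `|limn s - s n| < eta / (2 * (C + 1)).
  by have /cvgrPdist_lt := s_cvg; apply.
case=> T _ TP; have [T' TT' ET'] := Einf (eta / 2) T (ltac:(lra)).
exists T' => t T't; rewrite -(subnKC T't).
apply: le_lt_trans (descent_le T' (t - T') C0 a0 g0 Estep) _.
have /= := TP T' TT'; rewrite ger0_norm ?subr_ge0// ltr_pdivlMr ?mulr_gt0//; last lra.
have := s_lim T'; set l := limn s - s T' => _ l_lt.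
have : 0 <= l by rewrite subr_ge0.
by nra.
Qed.

End DescentSequences.

Section TotalEnergy.
Variables (R : realType) (N S : nat) (e : rel 'I_N).
Hypotheses (e_sym : symmetric e) (e_conn : forall i j, connect e i j).
Implicit Types d mu : 'I_N -> 'cV[R]_S.

Definition coord_row d (s : 'I_S) : 'rV[R]_N := \row_i d i s 0.

Definition total_energy d : R := \sum_s energy e (coord_row d s).

Lemma coord_row_sum d s : \sum_i d i = 0 -> \sum_i coord_row d s 0 i = 0.
Proof.
move=> d0; transitivity ((\sum_i d i) s 0); last by rewrite d0 mxE.
by rewrite summxE; apply: eq_bigr => i _; rewrite mxE.
Qed.

Lemma total_energy_ge0 d : \sum_i d i = 0 -> 0 <= total_energy d.
Proof. by move=> d0; apply: sumr_ge0 => s _; rewrite energy_ge0// coord_row_sum. Qed.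

Lemma total_energy_coord d i s : \sum_i d i = 0 ->
  `|d i s 0| <= N%:R * Num.sqrt (2 * total_energy d).
Proof.
move=> d0; have := energy_coord e_sym e_conn i (coord_row_sum s d0).
rewrite mxE => /le_trans; apply; rewrite ler_wpM2l// ler_wsqrtr// ler_wpM2l//.
rewrite /total_energy (bigD1 s)//= lerDl; apply: sumr_ge0 => s' _.
by rewrite energy_ge0// coord_row_sum.
Qed.

Lemma total_energy_le d r : (forall i s, `|d i s 0| <= r) ->
  total_energy d <= S%:R * (energy_cst R e * r ^+ 2).
Proof.
move=> dr; have -> : S%:R * (energy_cst R e * r ^+ 2) =
    \sum_(s < S) energy_cst R e * r ^+ 2.
  by rewrite big_const_ord iter_addr_0 mulr_natl.
by apply: ler_sum => s _; apply: energy_le => i; rewrite mxE.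
Qed.

Lemma total_energy_step d mu a M : \sum_i d i = 0 ->
  (forall i s, 0 <= mu i s 0 <= M) ->
  total_energy (fun i => d i + a *: \sum_(j | e i j) (mu i - mu j)) <=
  total_energy d + 2 * a * \sum_i dot (mu i) (d i) +
  S%:R * ((N * N)%:R * M ^+ 2) * a ^+ 2.
Proof.
move=> d0 muM.
have -> : \sum_i dot (mu i) (d i) =
    \sum_s (coord_row d s *m (coord_row mu s)^T) 0 0.
  under [RHS]eq_bigr do rewrite mxE.
  rewrite exchange_big/=; apply: eq_bigr => i _; rewrite dotE.
  by apply: eq_bigr => s _; rewrite !mxE mulrC.
have -> : S%:R * ((N * N)%:R * M ^+ 2) * a ^+ 2 =
    \sum_(s < S) ((N * N)%:R * M ^+ 2 * a ^+ 2).
  by rewrite big_const_ord iter_addr_0 -mulrA mulr_natl.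
rewrite mulr_sumr -!big_split/=; apply: ler_sum => s _.
have -> : coord_row (fun i => d i + a *: \sum_(j | e i j) (mu i - mu j)) s =
    coord_row d s + a *: (coord_row mu s *m laplacian R e).
  apply/rowP => i; rewrite [LHS]mxE [LHS]mxE [RHS]mxE.
  rewrite [coord_row d s 0 i]mxE; congr (_ + _).
  rewrite [LHS]mxE [RHS]mxE; congr (_ * _).
  rewrite mul_laplacian// summxE; apply: eq_bigr => j _.
  by rewrite !mxE.
rewrite energy_step ?coord_row_sum// lerD2l mulrC ler_wpM2r ?sqr_ge0//.
by apply: laplacian_form_le => // i; rewrite mxE.
Qed.

Lemma sum_exchange_step mu : \sum_i \sum_(j | e i j) (mu i - mu j) = 0.
Proof.
have swap : \sum_i \sum_(j | e i j) (mu i - mu j) =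
    - \sum_i \sum_(j | e i j) (mu i - mu j).
  rewrite [LHS](exchange_big_dep xpredT)//= -sumrN; apply: eq_bigr => j _.
  rewrite -sumrN; under eq_bigl do rewrite e_sym.
  by apply: eq_bigr => i _; rewrite opprB.
by move/eqP: swap; rewrite -addr_eq0 -mulr2n -scaler_nat scaler_eq0 pnatr_eq0/= => /eqP.
Qed.

End TotalEnergy.

Section LocalSubgradient.
Variables (R : realType) (S n : nat).
Variables (c : 'cV[R]_n) (A : 'M[R]_(S, n)) (X : set 'cV[R]_n).

(** A multiplier is minus a subgradient, at [y], of the optimal value of the
    local problem as a function of the allocation, and it is bounded by the
    penalty, since otherwise the Lagrangian would be unbounded below in [v]. *)
Lemma loc_multiplier_subgradient M y mu : loc_multiplier c A X M y mu ->
  exists zv, [/\ loc_feasible A X y zv,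
    forall y' zv', loc_feasible A X y' zv' ->
      loc_cost c M zv <= loc_cost c M zv' + dot mu (y' - y) &
    forall s, 0 <= mu s 0 <= M].
Proof.
move=> [mu0 [f [[[zv zvy zvf] fmin] [flb _]]]]; exists zv; split=> //.
  move=> y' zv' [zv'D zv'y']; rewrite zvf.
  have : f <= loc_lagrangian c A M y mu zv' by apply: flb; exists zv'.
  move=> /le_trans; apply; rewrite lerD2l; apply: dot_le => // s.
  have := zv'y' s; rewrite !mxE; lra.
have mu_ge0 s : 0 <= mu s 0 by have := mu0 s; rewrite mxE.
suff sumM : \sum_s mu s 0 <= M.
  move=> s; rewrite mu_ge0/= (le_trans _ sumM)// (bigD1 s)//= lerDl.
  exact: sumr_ge0.
rewrite leNgt; apply/negP => Msum.
have [[zX v0] _] := zvy.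
pose l0 := loc_lagrangian c A M y mu zv.
pose r := (`|l0 - f| + 1) / (\sum_s mu s 0 - M).
have r0 : 0 <= r by apply: divr_ge0; [rewrite addr_ge0|rewrite subr_ge0 ltW].
have : f <= loc_lagrangian c A M y mu (zv.1, zv.2 + r).
  by apply: flb; exists (zv.1, zv.2 + r) => //; split=> //=; rewrite addr_ge0.
have -> : loc_lagrangian c A M y mu (zv.1, zv.2 + r) = l0 - r * (\sum_s mu s 0 - M).
  rewrite /l0 /loc_lagrangian /loc_cost/=.
  have -> : A *m zv.1 - (y + const_mx (zv.2 + r)) =
      A *m zv.1 - (y + const_mx zv.2) + (- r) *: const_mx 1.
    by apply/colP => s; rewrite !mxE; ring.
  rewrite dot_line.
  have -> : dot mu (const_mx 1) = \sum_s mu s 0.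
    by rewrite dotE; apply: eq_bigr => s _; rewrite mxE mulr1.
  by ring.
rewrite divfK ?subr_eq0 ?gt_eqF//.
by have := ler_norm (l0 - f); lra.
Qed.

End LocalSubgradient.

(** * Convergence of the allocations *)

Section Convergence.
Variables (R : realType) (N S : nat) (n : 'I_N -> nat).
Variables (c : forall i, 'cV[R]_(n i)) (A : forall i, 'M[R]_(S, n i)).
Variables (X : forall i, set 'cV[R]_(n i)) (b sigma : 'cV[R]_S).
Arguments X : clear implicits.
Variables (K : 'I_N -> finType) (V : forall i, K i -> 'cV[R]_(n i)).
Arguments V : clear implicits.
Hypotheses (VX : forall i k, X i (V i k)).
Hypothesis XV : forall i, X i `<=` finite_hull (V i).
Variables (e : rel 'I_N) (e_sym : symmetric e) (e_conn : forall i j, connect e i j).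
Hypotheses (N_gt0 : (0 < N)%N) (S_gt0 : (0 < S)%N).
Variable zopt : forall i, 'cV[R]_(n i).
Hypothesis zopt_optimal : lp_optimal c A X b sigma zopt.
Hypothesis zopt_unique : forall z, lp_optimal c A X b sigma z -> z = zopt.
Variable M : R.
Hypothesis penalty :
  forall (y : 'I_N -> 'cV[R]_S) z (v : 'I_N -> R),
    \sum_i y i = b - sigma ->
    (forall i, loc_feasible (A i) (X i) (y i) (z i, v i)) ->
    total_cost c zopt + \sum_i v i <= \sum_i loc_cost (c i) M (z i, v i).
Variable alpha : nat -> R.
Hypothesis alpha_ge0 : forall t, 0 <= alpha t.
Hypothesis alpha_pinfty : series alpha @ \oo --> +oo.
Hypothesis alpha_sqr : cvgn (series (fun t => alpha t ^+ 2)).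
Variables y mu : nat -> 'I_N -> 'cV[R]_S.
Hypothesis y_init : \sum_i y 0%N i = b - sigma.
Hypothesis mu_multiplier : forall t i,
  loc_multiplier (c i) (A i) (X i) M (y t i) (mu t i).
Hypothesis y_step : forall t i,
  y t.+1 i = y t i + alpha t *: \sum_(j | e i j) (mu t i - mu t j).

Let fopt := total_cost c zopt.
Let C := S%:R * ((N * N)%:R * M ^+ 2).

Let C_ge0 : 0 <= C.
Proof. by rewrite mulr_ge0// mulr_ge0// sqr_ge0. Qed.

Lemma allocation_sum t : \sum_i y t i = b - sigma.
Proof.
elim: t => [//|t IH]; under eq_bigr do rewrite y_step.
by rewrite big_split/= -scaler_sumr sum_exchange_step// scaler0 addr0.
Qed.

Let zv t i := projT1 (cid (loc_multiplier_subgradient (mu_multiplier t i))).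

Let zvP t i : [/\ loc_feasible (A i) (X i) (y t i) (zv t i),
  forall y' zv', loc_feasible (A i) (X i) y' zv' ->
    loc_cost (c i) M (zv t i) <= loc_cost (c i) M zv' + dot (mu t i) (y' - y t i) &
  forall s, 0 <= mu t i s 0 <= M].
Proof. exact: projT2 (cid (loc_multiplier_subgradient (mu_multiplier t i))). Qed.

Let z t i := (zv t i).1.
Let v t i := (zv t i).2.
Let gap t := \sum_i loc_cost (c i) M (zv t i) - fopt.

Let v_ge0 t i : 0 <= v t i.
Proof. by have [[[_ v0] _] _ _] := zvP t i. Qed.

Let slack_le_gap t : \sum_i v t i <= gap t.
Proof.
rewrite lerBrDl; have -> : \sum_i loc_cost (c i) M (zv t i) =
    \sum_i loc_cost (c i) M (z t i, v t i).
  by apply: eq_bigr => i _; rewrite -surjective_pairing.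
apply: (@penalty (y t)) => [|i]; first exact: allocation_sum.
by rewrite -surjective_pairing; have [] := zvP t i.
Qed.

Let gap_ge0 t : 0 <= gap t.
Proof. by apply: le_trans (slack_le_gap t); apply: sumr_ge0. Qed.

(** Allocations at which the optimum of the restricted problem satisfies every
    local constraint: these are minimizers of the sum of the local optimal
    values, towards which the subgradient steps decrease the distance. *)
Let reference (yr : 'I_N -> 'cV[R]_S) :=
  \sum_i yr i = b - sigma /\ forall i, vle (A i *m zopt i) (yr i).

Let distance yr t := total_energy e (fun i => y t i - yr i).

Let diff_sum yr t : reference yr -> \sum_i (y t i - yr i) = 0.
Proof. by move=> [yrs _]; rewrite sumrB allocation_sum yrs subrr. Qed.

(** The subgradient inequality at the reference allocation, whose total local
    cost is [fopt]. *)
Let distance_step yr t : reference yr ->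
  distance yr t.+1 <= distance yr t - alpha t * (2 * gap t) + C * alpha t ^+ 2.
Proof.
move=> yrr; have := total_energy_step e_sym e_conn (alpha t) (diff_sum t yrr)
  (fun i => let: And3 _ _ h := zvP t i in h).
have -> : (fun i => y t i - yr i + alpha t *: \sum_(j | e i j) (mu t i - mu t j))
    = (fun i => y t.+1 i - yr i).
  by apply: funext => i; rewrite y_step addrAC.
move=> /le_trans; apply; rewrite lerD2r lerD2l.
suff : \sum_i dot (mu t i) (y t i - yr i) <= - gap t.
  by move=> h; have := ler_wpM2l (alpha_ge0 t) h; lra.
rewrite /gap opprB /fopt lerBrDr -big_split/=; apply: ler_sum => i _.
have feas : loc_feasible (A i) (X i) (yr i) (zopt i, 0).
  split; first by split=> //=; exact: zopt_optimal.1.1.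
  by move=> s; rewrite shift_coord addr0; exact: yrr.2.
have [_ /(_ _ _ feas) + _] := zvP t i.
by rewrite {2}/loc_cost/= mulr0 addr0 -(opprB (y t i)) dotNr; lra.
Qed.

(** The resources left over by the optimum are shared equally. *)
Let reference0 i : 'cV[R]_S :=
  A i *m zopt i + N%:R^-1 *: (b - sigma - \sum_j A j *m zopt j).

Let reference0P : reference reference0.
Proof.
split=> [|i s].
  rewrite /reference0 big_split/= big_const_ord iter_addr_0 -scaler_nat scalerA.
  by rewrite divff ?pnatr_eq0 -?lt0n// scale1r subrKC.
rewrite [leRHS]mxE lerDl mxE mulr_ge0 ?invr_ge0// sub_coord subr_ge0.
exact: zopt_optimal.1.2.
Qed.

Let distance_ge0 yr t : reference yr -> 0 <= distance yr t.
Proof. by move=> yrr; apply: total_energy_ge0 => //; exact: diff_sum. Qed.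

Let allocation_bounded i s : exists B, forall t, `|y t i s 0| <= B.
Proof.
pose D := distance reference0 0 + C * (limn (series (fun t => alpha t ^+ 2)) -
  series (fun t => alpha t ^+ 2) 0%N).
exists (N%:R * Num.sqrt (2 * D) + `|reference0 i s 0|) => t.
have -> : y t i s 0 = (y t i - reference0 i) s 0 + reference0 i s 0.
  by rewrite sub_coord subrK.
rewrite (le_trans (ler_normD _ _))// lerD2r.
have := total_energy_coord e_sym e_conn i s (diff_sum t reference0P).
move=> /le_trans; apply; rewrite ler_wpM2l// ler_wsqrtr// ler_wpM2l//.
have := @descent_le _ _ alpha_sqr (distance reference0) (fun t => 2 * gap t) C 0 t C_ge0
  alpha_ge0; apply=> t'; first by rewrite mulr_ge0.
exact: distance_step.
Qed.

(** Along a subsequence whose penalized cost tends to its optimal value, the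
    violations vanish, so that a limit of the local solutions is optimal for the
    restricted problem. By uniqueness it is [zopt], and it complies with the limit
    of the allocations. *)
Lemma cluster_reference : exists2 yr, reference yr &
  forall r T, 0 < r -> exists2 t, (T <= t)%N & forall i s, `|(y t i - yr i) s 0| <= r.
Proof.
have gap_inf eta T : 0 < eta -> exists2 t, (T <= t)%N & gap t < eta.
  move=> eta0; have eta2 : 0 < 2 * eta by rewrite mulr_gt0.
  have [t Tt gt] := descent_gap alpha_sqr C_ge0 alpha_ge0 alpha_pinfty
    (fun t => distance_ge0 t reference0P) (fun t => distance_step t reference0P)
    T eta2.
  by exists t => //; rewrite ltr_pM2l in gt.
have /choice[tk tkP] k : exists t, (k <= t)%N /\ gap t < harmonic k.
  by have [t ? ?] := gap_inf (harmonic k) k (harmonic_gt0 k); exists t.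
have [G [GU ooG]] := ultraFilterLemma (eventually_filter : ProperFilter \oo).
have harm0 : (harmonic k : R) @[k --> G] --> 0.
  by apply: cvg_trans cvg_harmonic; exact: cvg_fmap2.
have yl i s : exists l : R, y (tk k) i s 0 @[k --> G] --> l.
  have [B yB] := allocation_bounded i s.
  by apply: (ultra_bounded_cvg GU (B := B)) => k; exact: yB.
pose yr i : 'cV[R]_S := \col_s projT1 (cid (yl i s)).
have yrP i s : y (tk k) i s 0 @[k --> G] --> yr i s 0.
  by rewrite mxE; exact: projT2 (cid (yl i s)).
have vl i : v (tk k) i @[k --> G] --> 0.
  apply: (squeeze_cvgr (f := fun=> 0) (h := harmonic)) => //; last exact: cvg_cst.
  apply: filterE => k; rewrite v_ge0/= (le_trans _ (ltW (tkP k).2))//.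
  rewrite (le_trans _ (slack_le_gap _))// (bigD1 i)//= lerDl.
  exact: sumr_ge0.
have zw t i : exists w, simplex w /\ z t i = \sum_k w k *: V i k.
  have [[[zX _] _] _ _] := zvP t i.
  by have [w ws zE] := sub_finite_hull (@XV i) zX; exists w.
pose w t i := projT1 (cid (zw t i)).
have wP t i : simplex (w t i) /\ z t i = \sum_k w t i k *: V i k.
  exact: projT2 (cid (zw t i)).
have wl i k : exists l : R, w (tk k') i k @[k' --> G] --> l.
  apply: (ultra_bounded_cvg GU (B := 1)) => k'.
  by rewrite ger0_norm ?(wP _ _).1.1// simplex_le1//; exact: (wP _ _).1.
pose wr i k := projT1 (cid (wl i k)).
have wrP i k : w (tk k') i k @[k' --> G] --> wr i k by exact: projT2 (cid (wl i k)).
have wrs i : simplex (wr i).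
  split=> [k|].
    apply: (cvgr_to_ge (wrP i k)); apply: filterE => k'; exact: (wP _ _).1.1.
  have h : \sum_k w (tk k') i k @[k' --> G] --> \sum_k wr i k.
    by apply: cvg_sumr => k; exact: wrP.
  have h1 : \sum_k w (tk k') i k @[k' --> G] --> (1 : R).
    by under eq_fun do rewrite (wP _ _).1.2; exact: cvg_cst.
  exact: cvg_unique h h1.
pose zr i := \sum_k wr i k *: V i k.
have zrP i j : z (tk k) i j 0 @[k --> G] --> zr i j 0.
  rewrite summxE; under eq_fun do rewrite (wP _ _).2 summxE.
  apply: cvg_sumr => k; rewrite mxE; under eq_fun do rewrite mxE.
  by apply: cvgMl; exact: wrP.
have zrX i : convex_hull (X i) (zr i) by exact: convex_hull_finite.
have Azr i : vle (A i *m zr i) (yr i).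
  move=> s; rewrite -subr_ge0.
  have h : y (tk k) i s 0 + v (tk k) i - (A i *m z (tk k) i) s 0 @[k --> G] -->
      yr i s 0 + 0 - (A i *m zr i) s 0.
    by apply: cvgB; [apply: cvgD|exact: cvg_mulmx_coord].
  rewrite addr0 in h; apply: (cvgr_to_ge h); apply: filterE => k.
  have [[_ Az] _ _] := zvP (tk k) i.
  by have := Az s; rewrite shift_coord subr_ge0.
have yr_sum : \sum_i yr i = b - sigma.
  apply/colP => s; rewrite summxE.
  have h : \sum_i y (tk k) i s 0 @[k --> G] --> \sum_i yr i s 0.
    by apply: cvg_sumr => i; exact: yrP.
  have h1 : \sum_i y (tk k) i s 0 @[k --> G] --> (b - sigma) s 0.
    under eq_fun do rewrite -summxE allocation_sum.
    exact: cvg_cst.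
  exact: cvg_unique h h1.
have zr_cost : total_cost c zr <= fopt.
  have h : total_cost c (z (tk k)) - harmonic k @[k --> G] --> total_cost c zr - 0.
    by apply: cvgB => //; apply: cvg_sumr => i; exact: cvg_mulmx_coord.
  rewrite subr0 in h; apply: (cvgr_to_le h); apply: filterE => k.
  have : total_cost c (z (tk k)) <= \sum_i loc_cost (c i) M (zv (tk k) i).
    apply: ler_sum => i _; rewrite /loc_cost lerDl mulr_ge0//; last exact: v_ge0.
    have s0 : 'I_S by exact: Ordinal S_gt0.
    by have [_ _ /(_ s0)/andP[/le_trans]] := zvP (tk k) i; apply.
  by have [_] := tkP k; rewrite /gap; lra.
have zrE : zr = zopt.
  apply: zopt_unique; split; first split=> // s.
    rewrite -yr_sum !summxE; apply: ler_sum => i _; exact: Azr.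
  by move=> z' /zopt_optimal.2; exact: le_trans.
exists yr; first by split=> // i; rewrite -zrE.
move=> r T r0.
have : \forall k \near G, (T <= k)%N /\
    forall i s, `|yr i s 0 - y (tk k) i s 0| < r.
  apply: filterI; first by apply: ooG; exists T.
  apply: filter_forall => i; apply: filter_forall => s.
  exact: cvgr_dist_lt (yrP i s) _ r0.
move=> /filter_ex[k [Tk kr]]; exists (tk k).
  exact: leq_trans Tk (tkP k).1.
by move=> i s; rewrite sub_coord distrC ltW// kr.
Qed.

(** The distance to the cluster point of [cluster_reference] is arbitrarily small
    at some late times, hence tends to 0 by [descent_limit]. *)
Lemma allocations_converge eps : 0 < eps -> exists T, forall t, (T <= t)%N ->
  forall i, vle (A i *m zopt i) (y t i + const_mx eps).
Proof.
move=> eps0; have [yr yrr yr_cluster] := cluster_reference.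
have dist_inf eta T : 0 < eta -> exists2 t, (T <= t)%N & distance yr t < eta.
  move=> eta0; pose B := S%:R * energy_cst R e + 1.
  have B0 : 0 < B.
    by apply: ltr_wpDl => //; rewrite mulr_ge0// /energy_cst !sumr_ge0// => ? _;
       rewrite sumr_ge0.
  have r0 : 0 < Num.sqrt (eta / B) by rewrite sqrtr_gt0 divr_gt0.
  have [t Tt tr] := yr_cluster _ T r0; exists t => //.
  apply: le_lt_trans (total_energy_le e tr) _.
  rewrite sqr_sqrtr ?divr_ge0 ?ltW// mulrA mulrA ltr_pdivrMr// mulrC ltr_pM2l//.
  by rewrite /B ltrDl.
(* The threshold at which [total_energy_coord] bounds each coordinate by eps. *)
pose eta := (eps / N%:R) ^+ 2 / 2.
have eta0 : 0 < eta by rewrite divr_gt0// exprn_gt0// divr_gt0// ltr0n.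
have [|T TP] := descent_limit alpha_sqr C_ge0 alpha_ge0 (g := fun t => 2 * gap t) _
  (fun t => distance_step t yrr) dist_inf eta0.
  by move=> t; rewrite mulr_ge0.
exists T => t Tt i s; rewrite (le_trans (yrr.2 i s))//.
rewrite shift_coord -lerBlDl.
have := total_energy_coord e_sym e_conn i s (diff_sum t yrr).
rewrite sub_coord ler_norml => /andP[+ _].
suff : N%:R * Num.sqrt (2 * distance yr t) <= eps by rewrite /distance; lra.
rewrite mulrC -ler_pdivlMr ?ltr0n//.
have epsN : 0 <= eps / N%:R by rewrite divr_ge0// ltW.
rewrite -[leRHS](ger0_norm epsN) -sqrtr_sqr ler_wsqrtr//.
by have := TP t Tt; rewrite /eta; lra.
Qed.

End Convergence.

(** * Finite-time feasibility *)

Theorem mainTheorem5 (R : realType) (N S : nat) (p q : 'I_N -> nat)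
  (P : forall i, set 'cV[R]_(p i + q i))
  (X : forall i, set 'cV[R]_(p i + q i))
  (c : forall i, 'cV[R]_(p i + q i))
  (A : forall i, 'M[R]_(S, p i + q i))
  (b : 'cV[R]_S)
  (e : rel 'I_N)
  (delta : R)
  (hN : (0 < N)%N) (hS : (0 < S)%N)
  (hP : forall i, [/\ polyhedron (P i), P i !=set0 & compact (P i)])
  (hX : forall i, X i = mixed_integer_points (P i))
  (hMILP : exists x, milp_feasible A X b x)
  (he_sym : symmetric e)
  (he_conn : forall i j, connect e i j)
  (hdelta : 0 < delta)
  (hLP : exists z, lp_feasible A X b (sigma_FT A X delta) z)
  (hLP_uniq : exists! z, lp_optimal c A X b (sigma_FT A X delta) z) :
  exists2 M0 : R, 0 < M0 & forall M : R, M0 <= M ->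
  forall alpha : nat -> R,
    (forall t, 0 <= alpha t) ->
    series alpha @ \oo --> +oo ->
    cvgn (series (fun t => alpha t ^+ 2)) ->
  forall (y mu : nat -> 'I_N -> 'cV[R]_S)
    (x : nat -> forall i, 'cV[R]_(p i + q i)),
    \sum_(i < N) y 0%N i = b - sigma_FT A X delta ->
    algorithm_run c A X e M alpha y mu x ->
  exists2 T : nat, (0 < T)%N & forall t, (T <= t)%N ->
    (forall i, X i (x t i)) /\ vle (\sum_(i < N) A i *m x t i) b.
Proof.
have [zopt [zopt_optimal zopt_uniq]] := hLP_uniq.
have zopt_unique z : lp_optimal c A X b (sigma_FT A X delta) z -> z = zopt.
  by move=> /zopt_uniq.
have X0 i : X i !=set0 by have [x [Xx _]] := hMILP; exists (x i).
have Xc i : ultra_closed (X i).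
  by rewrite hX; have [? _ ?] := hP i; exact: mixed_integer_ultra_closed.
have X_bounded i : exists B, forall x, X i x -> forall j, `|x j 0| <= B.
  have [_ _ /compact_coord_bounded[B PB]] := hP i.
  by exists B => x; rewrite hX => -[Px _]; exact: PB.
have hull i : exists KV : {K : finType & K -> 'cV[R]_(p i + q i)},
    (forall k, X i (projT2 KV k)) /\ X i `<=` finite_hull (projT2 KV).
  have [[m [G [h PE]]] _ /compact_coord_bounded[B' PB]] := hP i.
  have := @mixed_integer_finite_hull R (p i) (q i) m G h B'.
  rewrite -PE -hX => /(_ PB (X0 i))[K [V [VX XV]]].
  by exists (existT _ K V).
pose V i := projT2 (projT1 (cid (hull i))).
have VX i k : X i (V i k) by exact: (projT2 (cid (hull i))).1.
have XV i : X i `<=` finite_hull (V i) by exact: (projT2 (cid (hull i))).2.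
have [M0 M00 M0P] := exact_penalty VX XV zopt_optimal.
exists M0 => // M MM0 alpha a0 aoo a2 y mu x y0 run.
have mu_mult t i : loc_multiplier (c i) (A i) (X i) M (y t i) (mu t i).
  by have [] := run t i.
have y_step t i : y t.+1 i = y t i + alpha t *: \sum_(j | e i j) (mu t i - mu t j).
  by have [] := run t i.
have x_lex t i : lex_solution (c i) (A i) (X i) (y t i) (x t i).
  by have [] := run t i.
have y_sum := allocation_sum he_sym y0 y_step.
have eps0 : 0 < delta / N%:R by rewrite divr_gt0// ltr0n.
have [T TP] := allocations_converge VX XV he_sym he_conn hN hS zopt_optimal
  zopt_unique (M0P M MM0) a0 aoo a2 y0 mu_mult y_step eps0.
exists T.+1 => // t Tt; have {TP} zy := TP t (ltnW Tt).
split=> [i|s]; first by have [rho [xi [[]]]] := x_lex t i.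
set F := [set i | ~~ `[< X i (zopt i) >]]%SET.
have F_le : (#|F| <= S)%N by exact: unique_optimum_few_fractional zopt_optimal zopt_unique.
pose m := setmax (range (fun i => sigma_loc (A i) (X i) s 0)).
have sigma_le i : sigma_loc (A i) (X i) s 0 <= m.
  by apply/(setmax_range_le (fun i => sigma_loc (A i) (X i) s 0)): i; rewrite ?card_ord.
have m0 : 0 <= m.
  have i0 : 'I_N by exact: Ordinal hN.
  have [B XB] := X_bounded i0.
  apply: le_trans (sigma_le i0); exact: (sigma_loc_ge0 _ hS (Xc i0) (X0 i0) XB s).
(* Integral components of the optimum cost no extra resource; the other ones,
   at most S in number, cost at most m each. *)
have use i : (A i *m x t i) s 0 <= y t i s 0 + delta / N%:R + (if i \in F then m else 0).
  have [iF|iF] := boolP (i \in F).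
    have [B XB] := X_bounded i.
    apply: le_trans (_ : _ <= y t i s 0 + delta / N%:R + sigma_loc (A i) (X i) s 0) _.
      by apply: (lex_resource hS (Xc i) (X0 i) XB s (x_lex t i) _ (ltW eps0) (zy i));
         exact: zopt_optimal.1.1.
    by rewrite lerD2l.
  rewrite addr0; apply: (lex_resource_integral s (x_lex t i) _ (ltW eps0) (zy i)).
  by move: iF; rewrite inE negbK => /asboolP.
rewrite summxE (le_trans (ler_sum _ (fun i _ => use i)))//.
rewrite !big_split/= -big_mkcond/= !sumr_const card_ord.
rewrite -summxE y_sum -[delta / _ *+ N]mulr_natr divfK ?pnatr_eq0 -?lt0n//.
have -> : (b - sigma_FT A X delta) s 0 = b s 0 - (S%:R * m + delta).
  by rewrite sub_coord shift_coord /sigma_infty [in LHS]mxE [in LHS]mxE.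
rewrite -[m *+ _]mulr_natl.
have : #|F|%:R * m <= S%:R * m by rewrite ler_wpM2r// ler_nat.
by lra.
Qed.
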